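(* Let $A\in\mathbb{R}^{n\times n}$ be symmetric positive definite. The $A$-Wasserstein distance $W_A(\mu,\nu)$ between Gaussian distributions $\mu=\mathcal{N}(x_\mu,\Sigma_\mu)$ and $\nu=\mathcal{N}(x_\nu,\Sigma_\nu)$ on $\mathbb{R}^n$ satisfies $$\left(W_A(\mu,\nu)\right)^2=\|x_\mu-x_\nu\|_A^2+\operatorname{trace}(\widetilde\Sigma_\mu)+\operatorname{trace}(\widetilde\Sigma_\nu)-2\operatorname{trace}\left(\left(\widetilde\Sigma_\mu^{1/2}\,\widetilde\Sigma_\nu\,\widetilde\Sigma_\mu^{1/2}\right)^{1/2}\right),$$ where $\widetilde\Sigma_\mu=A^{1/2}\Sigma_\mu A^{1/2}$ and $\widetilde\Sigma_\nu=A^{1/2}\Sigma_\nu A^{1/2}$.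
   Context: $\mathcal{N}(x,\Sigma)$ denotes the Gaussian distribution on $\mathbb{R}^n$ with mean $x\in\mathbb{R}^n$ and (symmetric positive semi-definite, possibly singular) covariance $\Sigma\in\mathbb{R}^{n\times n}$. For a symmetric positive semi-definite matrix $M$, $M^{1/2}$ is its symmetric positive semi-definite square root. For symmetric positive definite $A$, $\|x\|_A=\|A^{1/2}x\|_2$. The $A$-Wasserstein distance between $\mu$ and $\nu$ is $$W_A(\mu,\nu)=\left(\inf_{\pi\in\Pi(\mu,\nu)}\int_{\mathbb{R}^n\times\mathbb{R}^n}\|M-N\|_A^2\,d\pi(M,N)\right)^{1/2},$$ where $\Pi(\mu,\nu)$ is the set of couplings of $\mu$ and $\nu$, i.e. probability distributions on $\mathbb{R}^n\times\mathbb{R}^n$ having $\mu$ and $\nu$ as marginal distributions. *)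

(* Defs.v *)
From HB Require Import structures.
From mathcomp Require Import all_boot all_order all_algebra.
From mathcomp Require Import all_classical all_reals all_analysis.
From mathcomp Require Import measurable_realfun.

Set Implicit Arguments.
Unset Strict Implicit.
Unset Printing Implicit Defensive.

Import Order.TTheory GRing.Theory Num.Theory.
Import numFieldNormedType.Exports.

Local Open Scope classical_set_scope.
Local Open Scope ring_scope.

Definition possemidefmx (R : realType) n (M : 'M[R]_n) : Prop :=
  M^T = M /\ forall v : 'cV[R]_n, 0 <= (v^T *m M *m v) 0 0.

Definition posdefmx (R : realType) n (M : 'M[R]_n) : Prop :=
  M^T = M /\ forall v : 'cV[R]_n, v != 0 -> 0 < (v^T *m M *m v) 0 0.

(* The default value 0 of xget is only reached when M is not symmetric positive
   semi-definite; otherwise the square root exists and is unique. *)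
Definition sqrtmx (R : realType) n (M : 'M[R]_n) : 'M[R]_n :=
  xget 0 [set B : 'M[R]_n | possemidefmx B /\ B *m B = M].

(* `|x| is the sup norm on matrices, hence a separate Euclidean norm. *)
Definition norm2 (R : realType) n (x : 'cV[R]_n) : R :=
  Num.sqrt (\sum_i x i 0 ^+ 2).

Definition normA (R : realType) n (A : 'M[R]_n) (x : 'cV[R]_n) : R :=
  norm2 (sqrtmx A *m x).

(* R^n carries the sigma-algebra generated by the coordinates, that is, the
   Borel sigma-algebra; this mirrors the library's structure on n.-tuple. *)
Section measurable_cV.
Context (R : realType) (n : nat).

Let coord (i : 'I_n) (x : 'cV[R]_n) : R := x i 0.

Let cV_set0 : g_sigma_preimage coord set0.
Proof. exact: sigma_algebra0. Qed.

Let cV_setC A : g_sigma_preimage coord A -> g_sigma_preimage coord (~` A).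
Proof. exact: sigma_algebraC. Qed.

Let cV_bigcup (F : (set 'cV[R]_n)^nat) :
  (forall i, g_sigma_preimage coord (F i)) ->
  g_sigma_preimage coord (\bigcup_i (F i)).
Proof. exact: sigma_algebra_bigcup. Qed.

HB.instance Definition _ := @isMeasurable.Build default_measure_display
  'cV[R]_n (g_sigma_preimage coord) cV_set0 cV_setC cV_bigcup.

Lemma measurable_fun_cV d (T : measurableType d) (f : T -> 'cV[R]_n) :
  (forall i, measurable_fun setT (fun t => f t i 0)) -> measurable_fun setT f.
Proof.
move=> mf; apply: (@measurability _ _ _ _ _ f
    (\big[setU/set0]_(i < n) preimage_set_system setT (coord i) measurable)).
  by [].
move=> _ [B + <-]; rewrite -bigcup_seq => -[i _ [C mC <-]].
rewrite setTI; exact: mf.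
Qed.

End measurable_cV.

Section standard_gaussian.
Context (R : realType).

(* measurableTypeR R, the type on which normal_prob lives, is R with the same
   sigma-algebra under another display. *)
Definition cons_tuple_pair n (z : measurableTypeR R * n.-tuple R) :
    n.+1.-tuple R :=
  [the n.+1.-tuple R of (z.1 : R) :: z.2].

Lemma measurable_cons_tuple_pair n : measurable_fun setT (@cons_tuple_pair n).
Proof.
apply: (measurable_cons (f := fun z : measurableTypeR R * n.-tuple R => z.1 : R)
  (g := snd)); last exact: measurable_snd.
exact: (@measurable_fst _ _ (measurableTypeR R) (n.-tuple R)).
Qed.

HB.instance Definition _ n := isMeasurableFun.Build _ _ _ _
  (@cons_tuple_pair n) (@measurable_cons_tuple_pair n).

(* the law of n independent N(0, 1) coordinates: the n-fold product measure *)
Fixpoint std_gaussian n : probability (n.-tuple R) R :=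
  match n with
  | 0 => dirac [tuple]
  | n'.+1 => distribution (normal_prob 0 1 \x std_gaussian n')%E
               (@cons_tuple_pair n')
  end.

End standard_gaussian.

Section gaussian.
Context (R : realType) (n : nat).

Definition affine_map (x : 'cV[R]_n) (B : 'M[R]_n) (z : n.-tuple R) : 'cV[R]_n :=
  x + B *m (\col_i tnth z i).

Lemma measurable_affine_map x B : measurable_fun setT (affine_map x B).
Proof.
apply: measurable_fun_cV => i.
rewrite (_ : (fun _ => _) =
  (fun z => x i 0 + \sum_(j < n) B i j * tnth z j)); last first.
  apply/funext => z; rewrite !mxE; congr (_ + _).
  by apply: eq_bigr => j _; rewrite mxE.
apply: measurable_funD => //; apply: measurable_sum => j.
by apply: measurable_funM => //; exact: measurable_tnth.
Qed.

HB.instance Definition _ x B := isMeasurableFun.Build _ _ _ _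
  (affine_map x B) (measurable_affine_map x B).

(* N(x, S) is the law of x + S^(1/2) Z with Z standard Gaussian on R^n; this
   makes sense also when S is singular and no density exists. *)
Definition gaussian (x : 'cV[R]_n) (S : 'M[R]_n) : probability 'cV[R]_n R :=
  distribution (std_gaussian R n) (affine_map x (sqrtmx S)).

End gaussian.

Section wasserstein.
Context (R : realType) (n : nat).
Local Open Scope ereal_scope.

Definition couplings (mu nu : probability 'cV[R]_n R) :
    set (probability ('cV[R]_n * 'cV[R]_n)%type R) :=
  [set pi | (forall B, measurable B -> pushforward pi fst B = mu B) /\
            (forall B, measurable B -> pushforward pi snd B = nu B)].

Definition wasserstein (A : 'M[R]_n) (mu nu : probability 'cV[R]_n R) : \bar R :=
  sqrte (ereal_inf
    [set \int[pi]_z ((normA A (z.1 - z.2) ^+ 2)%:E) | pi in couplings mu nu]).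

End wasserstein.

(* Main.v *)
From HB Require Import structures.
Require Import Defs.
From mathcomp Require Import all_boot all_order all_algebra.
From mathcomp Require Import all_classical all_reals all_analysis.
From mathcomp Require Import measurable_realfun ring lra.

(** Write [C] for the square root of [A], and centre and rescale a coupling
    [(M, N)] as [U = C (M - xmu)], [V = C (N - xnu)], with covariances [Tmu]
    and [Tnu]. Expanding the square, the expected cost is
    [|C (xmu - xnu)|^2 + tr Tmu + tr Tnu - 2 E<U, V>], so the theorem says that
    the largest possible [E<U, V>] is the trace of [D = (S Tnu S)^(1/2)], with
    [S = Tmu^(1/2)].

    Upper bound on [E<U, V>]. For positive definite [P], the inequality
    [2 <u, v> <= <u, P u> + <v, P^-1 v>] bounds the cost from below by a function
    of [M] plus a function of [N]; its integral depends on the marginals only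
    and involves [tr (P Tmu) + tr (P^-1 Tnu)] (coupling_cost_lower). When both
    covariances are invertible the best [P] is [S^-1 D S^-1], which makes this
    sum equal to [2 tr D]. For singular covariances [S] and [D] are perturbed by
    multiples of the identity, and the sum comes arbitrarily close to [2 tr D]
    (fidelity_dual).

    Attainment. If [Z] is standard Gaussian and [O] orthogonal, then [O Z] is
    standard Gaussian, so [xmu + Smu^(1/2) Z] and [xnu + Snu^(1/2) O Z] form a
    coupling, for which [E<U, V> = tr (X^T Y O)] with [X = C Smu^(1/2)] and
    [Y = C Snu^(1/2)]. Since [X X^T = S S] and [D D = (S Y) (S Y)^T], two
    factorizations of the same Gram matrix differ by an orthogonal matrix
    (gram_orthogonal, a product of Householder reflections), which gives an [O]
    with [tr (X^T Y O) = tr D] (fidelity_attained).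

    Three ingredients are proved on the way. Square roots of positive
    semi-definite matrices exist (possemidefmx_sqrt_exists): a maximizer of the
    Rayleigh quotient is an eigenvector, and a reflection splits it off. The
    standard Gaussian is invariant under orthogonal matrices
    (std_gaussian_rotation): by induction on the dimension an orthogonal matrix
    is a product of planar rotations of the first two coordinates and of
    orthogonal matrices fixing the first one (in dimension one, a sign), and in
    the plane the invariance follows from that of the density and two affine
    changes of variable. The
    moments of the standard Gaussian (std_gaussian_quadratic) follow from this
    invariance and from the variance of [N(0, 1)]. *)

Set Implicit Arguments.
Unset Strict Implicit.
Unset Printing Implicit Defensive.

Import Order.TTheory GRing.Theory Num.Theory.
Import numFieldNormedType.Exports.

Local Open Scope classical_set_scope.
Local Open Scope ring_scope.

(** * Orthogonal matrices and Gram matrices *)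

Definition dotv (R : realType) n (u v : 'cV[R]_n) : R := (u^T *m v) 0 0.

Section dot.
Context (R : realType) (n : nat).
Implicit Types (u v w : 'cV[R]_n).

Lemma dotvE u v : dotv u v = \sum_i u i 0 * v i 0.
Proof. by rewrite /dotv mxE; apply: eq_bigr => i _; rewrite mxE. Qed.

Lemma dotvC u v : dotv u v = dotv v u.
Proof. by rewrite !dotvE; apply: eq_bigr => i _; rewrite mulrC. Qed.

Lemma dotvDl u v w : dotv (u + v) w = dotv u w + dotv v w.
Proof. by rewrite /dotv linearD/= mulmxDl mxE. Qed.

Lemma dotvDr u v w : dotv w (u + v) = dotv w u + dotv w v.
Proof. by rewrite /dotv mulmxDr mxE. Qed.

Lemma dotvNl u w : dotv (- u) w = - dotv u w.
Proof. by rewrite /dotv linearN/= mulNmx mxE. Qed.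

Lemma dotvNr u w : dotv w (- u) = - dotv w u.
Proof. by rewrite /dotv mulmxN mxE. Qed.

Lemma dotvZl a u w : dotv (a *: u) w = a * dotv u w.
Proof. by rewrite /dotv linearZ/= -scalemxAl mxE. Qed.

Lemma dotvZr a u w : dotv w (a *: u) = a * dotv w u.
Proof. by rewrite /dotv -scalemxAr mxE. Qed.

Definition dotvBE := (dotvDl, dotvDr, dotvNl, dotvNr, dotvZl, dotvZr).

Lemma dotv_ge0 u : 0 <= dotv u u.
Proof. by rewrite dotvE sumr_ge0// => i _; rewrite -expr2 sqr_ge0. Qed.

Lemma dotv_eq0 u : (dotv u u == 0) = (u == 0).
Proof.
apply/eqP/eqP => [|->]; last by rewrite /dotv mulmx0 mxE.
rewrite dotvE => /eqP; rewrite psumr_eq0 => [/allP u0|i _]; last first.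
  by rewrite -expr2 sqr_ge0.
apply/colP => i; have := u0 i (mem_index_enum _).
by rewrite -expr2 sqrf_eq0 mxE => /eqP.
Qed.

Lemma dotv_mulmxl m (B : 'M[R]_(n, m)) (x : 'cV[R]_m) v :
  dotv (B *m x) v = dotv x (B^T *m v).
Proof. by rewrite /dotv trmx_mul mulmxA. Qed.

Lemma mulmx_tr_self u v : u^T *m v = (dotv u v)%:M.
Proof. by rewrite [LHS]mx11_scalar. Qed.

End dot.

Definition orthogonalmx (R : realType) n (Q : 'M[R]_n) : Prop :=
  Q^T *m Q = 1%:M.

Section orthogonal.
Context (R : realType).

Lemma orthogonalmxC n (Q : 'M[R]_n) : orthogonalmx Q -> Q *m Q^T = 1%:M.
Proof. by move=> /mulmx1C. Qed.

Lemma orthogonalmx1 n : orthogonalmx (1%:M : 'M[R]_n).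
Proof. by rewrite /orthogonalmx trmx1 mulmx1. Qed.

Lemma orthogonalmxM n (P Q : 'M[R]_n) :
  orthogonalmx P -> orthogonalmx Q -> orthogonalmx (P *m Q).
Proof.
by rewrite /orthogonalmx => oP oQ; rewrite trmx_mul mulmxA -(mulmxA Q^T) oP mulmx1.
Qed.

Lemma orthogonalmxT n (Q : 'M[R]_n) : orthogonalmx Q -> orthogonalmx Q^T.
Proof. by move=> oQ; rewrite /orthogonalmx trmxK orthogonalmxC. Qed.

Lemma dotv_orthogonal n (Q : 'M[R]_n) (u v : 'cV[R]_n) :
  orthogonalmx Q -> dotv (Q *m u) (Q *m v) = dotv u v.
Proof. by move=> oQ; rewrite dotv_mulmxl mulmxA oQ mul1mx. Qed.

(** For [v = 0] the quotient is [2 / 0 = 0], so that the reflection is then the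
    identity; this is what makes householder_map hold also when [s = b]. *)
Definition householder n (v : 'cV[R]_n) : 'M[R]_n :=
  1%:M - (2 / dotv v v) *: (v *m v^T).

Lemma householderE n (v x : 'cV[R]_n) :
  householder v *m x = x - (2 / dotv v v * dotv v x) *: v.
Proof.
rewrite /householder mulmxBl mul1mx -scalemxAl -mulmxA mulmx_tr_self.
by rewrite mul_mx_scalar scalerA.
Qed.

Lemma householder_tr n (v : 'cV[R]_n) : (householder v)^T = householder v.
Proof. by rewrite /householder linearB/= trmx1 linearZ/= trmx_mul trmxK. Qed.

Lemma householder_orthogonal n (v : 'cV[R]_n) : orthogonalmx (householder v).
Proof.
rewrite /orthogonalmx householder_tr.
have [->|v0] := eqVneq v 0.
  by rewrite /householder mul0mx scaler0 subr0 mulmx1.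
have vv : v *m v^T *m (v *m v^T) = dotv v v *: (v *m v^T).
  by rewrite mulmxA -(mulmxA v) mulmx_tr_self mul_mx_scalar scalemxAl.
rewrite /householder mulmxBl mul1mx -scalemxAl mulmxBr mulmx1 -scalemxAr vv.
rewrite scalerA divfK ?dotv_eq0// scalerDl scale1r opprD addrA subrr sub0r.
by rewrite scalerN opprK subrK.
Qed.

Lemma householder_map n (s b : 'cV[R]_n) : dotv s s = dotv b b ->
  householder (s - b) *m s = b.
Proof.
move=> sb; rewrite householderE.
have [/eqP|v0] := eqVneq (s - b) 0.
  by rewrite subr_eq0 => /eqP ->; rewrite subrr scaler0 subr0.
have e : dotv (s - b) (s - b) = 2 * dotv (s - b) s.
  rewrite !dotvBE -sb (dotvC b s); ring.
have : dotv (s - b) (s - b) != 0 by rewrite dotv_eq0.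
rewrite {2}e => d0.
rewrite mulrAC -e divff ?dotv_eq0// scale1r opprB addrCA subrr addr0//.
Qed.

Lemma householder_fix n (v x : 'cV[R]_n) : dotv v x = 0 ->
  householder v *m x = x.
Proof. by move=> vx; rewrite householderE vx mulr0 scale0r subr0. Qed.

Lemma orthogonal_map n (s b : 'cV[R]_n) : dotv s s = dotv b b ->
  exists2 Q : 'M[R]_n, orthogonalmx Q & Q *m s = b.
Proof.
move=> sb; exists (householder (s - b)); first exact: householder_orthogonal.
exact: householder_map.
Qed.

(** Match the columns one after the other. If the first [k] columns already
    agree, the reflection exchanging the two columns of index [k] fixes the
    earlier ones, because equal Gram matrices make these orthogonal to the
    difference of the two columns. *)
Lemma gram_orthogonal m n (X Y : 'M[R]_(n, m)) : X^T *m X = Y^T *m Y ->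
  exists2 Q : 'M[R]_n, orthogonalmx Q & Q *m X = Y.
Proof.
move=> XY.
have dE i j : dotv (col i X) (col j X) = dotv (col i Y) (col j Y).
  have gramE (Z : 'M[R]_(n, m)) : dotv (col i Z) (col j Z) = (Z^T *m Z) i j.
    by rewrite dotvE mxE; apply: eq_bigr => k _; rewrite !mxE.
  by rewrite !gramE XY.
suff H k : exists2 Q : 'M[R]_n, orthogonalmx Q &
    forall i : 'I_m, (i < k)%N -> Q *m col i X = col i Y.
  have [Q oQ QX] := H m; exists Q => //.
  apply/matrixP => i j; have := QX j (ltn_ord j).
  by rewrite !colE mulmxA -!colE => /colP /(_ i); rewrite !mxE.
elim: k => [|k [Q oQ QX]]; first by exists 1%:M => //; exact: orthogonalmx1.
have [km|mk] := ltnP k m; last first.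
  by exists Q => // i _; apply: QX; exact: leq_trans (ltn_ord i) mk.
pose j := Ordinal km; pose H := householder (Q *m col j X - col j Y).
exists (H *m Q); first exact/orthogonalmxM/oQ/householder_orthogonal.
move=> i; rewrite ltnS leq_eqVlt => /orP[/eqP ik|ik]; rewrite -mulmxA.
  have -> : i = j by exact/val_inj.
  by apply: householder_map; rewrite dotv_orthogonal// dE.
rewrite QX//; apply: householder_fix.
by rewrite dotvDl dotvNl -{1}(QX i ik) dotv_orthogonal// dE subrr.
Qed.

End orthogonal.

(** * Square roots of positive semi-definite matrices *)

Section eigen.
Context (R : realType).

Lemma sym_dotv n (M : 'M[R]_n) u v : M^T = M -> dotv u (M *m v) = dotv v (M *m u).
Proof. by move=> sM; rewrite dotvC dotv_mulmxl sM. Qed.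

(** Perturb [v] in the direction [w = N v]: the quadratic form along [v + t w]
    is [2 t |w|^2 + t^2 <w, N w>], which is negative for small [t < 0] unless
    [w = 0]. *)
Lemma psd_null n (N : 'M[R]_n) v : N^T = N ->
  (forall w, 0 <= dotv w (N *m w)) -> dotv v (N *m v) = 0 -> N *m v = 0.
Proof.
move=> sN N0 v0; apply/eqP; rewrite -dotv_eq0.
set w := N *m v; set a := dotv w w; set k := dotv w (N *m w).
have a0 : 0 <= a := dotv_ge0 w.
have k0 : 0 <= k := N0 w.
(* This step length makes the quadratic form equal to [- t^2 (k + 2)]. *)
have := N0 (v + (- (a / (k + 1))) *: w).
rewrite mulmxDr -scalemxAr !dotvBE v0 (sym_dotv v w sN) -/w -/a -/k add0r.
set t := a / (k + 1).
have -> : a = t * (k + 1) by rewrite /t divfK// gt_eqF// ltr_wpDl.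
have t0 : 0 <= t by rewrite /t divr_ge0// addr_ge0.
move=> H.
suff : t = 0 by move=> ->; rewrite mul0r.
have h2 : 0 <= t * t * (- k - 2).
  by apply: le_trans H _; rewrite le_eqVlt; apply/orP; left; apply/eqP; ring.
have : t * t * (k + 2) <= 0 by nra.
rewrite pmulr_lle0 ?ltr_wpDl// => tt0.
by apply/eqP; rewrite -sqrf_eq0 expr2 eq_le tt0 mulr_ge0.
Qed.

Lemma quadform_continuous n (M : 'M[R]_n) :
  continuous (fun u : 'rV[R]_n => dotv u^T (M *m u^T)).
Proof.
rewrite (_ : (fun _ => _) =
    fun u : 'rV[R]_n => \sum_i u 0 i * (\sum_j M i j * u 0 j)); last first.
  apply/funext => u; rewrite dotvE; apply: eq_bigr => i _.
  by rewrite !mxE; congr (_ * _); apply: eq_bigr => j _; rewrite mxE.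
apply: continuous_big => [|i _].
  exact: add_continuous.
move=> u; apply: (@continuousM R 'rV[R]_n); first exact: coord_continuous.
apply: (@continuous_big _ _ _ _ _ _ _ _ (fun j (u : 'rV[R]_n) => M i j * u 0 j)) => [|j _ x].
  exact: add_continuous.
by apply: (@continuousM R 'rV[R]_n); [exact: cst_continuous|exact: coord_continuous].
Qed.

(** A maximizer of the quadratic form on the unit sphere, with maximum [l], is
    in the kernel of the positive semi-definite matrix [l - M]. *)
Lemma sym_eigenvector n (M : 'M[R]_n.+1) : M^T = M ->
  exists (v : 'cV[R]_n.+1) (l : R), dotv v v = 1 /\ M *m v = l *: v.
Proof.
move=> sM; pose q (u : 'rV[R]_n.+1) := dotv u^T (M *m u^T).
pose S := [set u : 'rV[R]_n.+1 | dotv u^T (1%:M *m u^T) = 1].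
have cS : compact S.
  apply: bounded_closed_compact.
    exists 1; split => // x x1 u Su; apply: ltW; apply: le_lt_trans x1.
    rewrite /Num.norm/= mx_normrE; apply/bigmax_leP; split => // -[i j] _ /=.
    rewrite ord1 -ler_sqr ?nnegrE// ?normr_ge0// expr1n -normrX ger0_norm ?sqr_ge0//.
    move: Su; rewrite /S/= mul1mx dotvE => <-.
    by rewrite (bigD1 j)//= mxE expr2 lerDl sumr_ge0// => k _; rewrite -expr2 sqr_ge0.
  apply: (@preimage_closed _ _ (fun u : 'rV[R]_n.+1 => dotv u^T (1%:M *m u^T))
    [set x | x = 1]); last exact: closed_eq.
  by move=> u _; exact: (@quadform_continuous _ 1%:M).
have S0 : S !=set0.
  exists (delta_mx 0 0); rewrite /S/= mul1mx dotvE (bigD1 0)//= !mxE eqxx mul1r.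
  by rewrite big1 ?addr0// => i /negPf i0; rewrite !mxE i0 andbF mul0r.
have [c cin cmax] := EVT_max_rV S0 cS
  (continuous_subspaceT (@quadform_continuous _ M)).
pose l := dotv c^T (M *m c^T).
have c1 : dotv c^T c^T = 1 by move: cin; rewrite inE /S/= mul1mx.
exists c^T, l; split => //; apply/eqP; rewrite eq_sym -subr_eq0; apply/eqP.
have -> : l *: c^T - M *m c^T = (l%:M - M) *m c^T.
  by rewrite mulmxBl mul_scalar_mx.
apply: psd_null.
- by rewrite linearB/= tr_scalar_mx sM.
- move=> w; rewrite mulmxBl mul_scalar_mx dotvDr dotvNr dotvZr subr_ge0.
  have [->|w0] := eqVneq w 0; first by rewrite /dotv !mulmx0 !mxE mulr0.
  have ww : 0 < dotv w w by rewrite lt_def dotv_eq0 w0 dotv_ge0.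
  pose a := (Num.sqrt (dotv w w))^-1.
  have aa : a * a = (dotv w w)^-1.
    by rewrite /a -invfM -expr2 sqr_sqrtr// ltW.
  have := cmax (a *: w)^T; rewrite !trmxK inE /S/= trmxK mul1mx -scalemxAr !dotvBE.
  rewrite !mulrA aa mulVf ?gt_eqF// => /(_ erefl).
  by rewrite mulrC ler_pdivrMr.
- by rewrite mulmxBl mul_scalar_mx dotvDr dotvNr dotvZr c1 mulr1 subrr.
Qed.

End eigen.

Section psd.
Context (R : realType).

Lemma possemidefmxP n (M : 'M[R]_n) :
  possemidefmx M <-> M^T = M /\ forall v, 0 <= dotv v (M *m v).
Proof.
split=> -[sM pM]; split=> // v; first by rewrite /dotv mulmxA; exact: pM.
by rewrite -mulmxA; exact: pM.
Qed.

Lemma possemidefmx_congr m n (M : 'M[R]_n) (X : 'M[R]_(n, m)) :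
  possemidefmx M -> possemidefmx (X^T *m M *m X).
Proof.
move=> /possemidefmxP[sM pM]; apply/possemidefmxP; split.
  by rewrite !trmx_mul trmxK sM mulmxA.
by move=> v; rewrite -!mulmxA dotvC dotv_mulmxl trmxK dotvC; exact: pM.
Qed.

Lemma possemidefmxD n (M N : 'M[R]_n) :
  possemidefmx M -> possemidefmx N -> possemidefmx (M + N).
Proof.
move=> /possemidefmxP[sM pM] /possemidefmxP[sN pN]; apply/possemidefmxP; split.
  by rewrite linearD/= sM sN.
by move=> v; rewrite mulmxDl dotvDr addr_ge0.
Qed.

Lemma possemidefmxZ n a (M : 'M[R]_n) :
  0 <= a -> possemidefmx M -> possemidefmx (a *: M).
Proof.
move=> a0 /possemidefmxP[sM pM]; apply/possemidefmxP; split.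
  by rewrite linearZ/= sM.
by move=> v; rewrite -scalemxAl dotvZr mulr_ge0.
Qed.

Lemma possemidefmx1 n : possemidefmx (1%:M : 'M[R]_n).
Proof.
apply/possemidefmxP; split; first exact: trmx1.
by move=> v; rewrite mul1mx dotv_ge0.
Qed.

Lemma dotv_col_mx m n (a c : 'cV[R]_m) (b d : 'cV[R]_n) :
  dotv (col_mx a b) (col_mx c d) = dotv a c + dotv b d.
Proof. by rewrite /dotv tr_col_mx mul_row_col mxE. Qed.

Lemma possemidefmx_block m n (M : 'M[R]_m) (N : 'M[R]_n) :
  possemidefmx (block_mx M 0 0 N) <-> possemidefmx M /\ possemidefmx N.
Proof.
split=> [/possemidefmxP[sMN pMN]|].
  move: sMN; rewrite tr_block_mx !trmx0 => /eq_block_mx[sM _ _ sN].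
  split; apply/possemidefmxP; split=> // v.
    have := pMN (col_mx v 0); rewrite mul_block_col !mulmx0 !addr0 mul0mx dotv_col_mx.
    by rewrite {2}/dotv mulmx0 mxE addr0.
  have := pMN (col_mx 0 v); rewrite mul_block_col !mulmx0 !add0r mul0mx dotv_col_mx.
  by rewrite {1}/dotv mulmx0 mxE add0r.
move=> [/possemidefmxP[sM pM] /possemidefmxP[sN pN]]; apply/possemidefmxP; split.
  by rewrite tr_block_mx !trmx0 sM sN.
move=> v; rewrite -(vsubmxK v) mul_block_col !mul0mx addr0 add0r dotv_col_mx.
by rewrite addr_ge0.
Qed.

(** A symmetric matrix leaves the orthogonal complement of an eigenvector
    invariant. *)
Lemma sym_block_first n (N : 'M[R]_(1 + n)) (l : R) : N^T = N ->
  N *m col_mx 1%:M 0 = l *: col_mx 1%:M 0 ->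
  N = block_mx l%:M 0 0 (drsubmx N).
Proof.
move=> sN; rewrite -{1}(submxK N) mul_block_col !mulmx0 !addr0 !mulmx1.
rewrite scale_col_mx scaler0 scale_scalar_mx mulr1 => /eq_col_mx[ulE dlE].
have urE : ursubmx N = 0.
  by rewrite -[N in LHS]sN -trmx_dlsub dlE trmx0.
by rewrite -[LHS]submxK ulE dlE urE.
Qed.

(** By induction on the dimension: an orthogonal matrix sending the first basis
    vector to a unit eigenvector reduces [M] to a block diagonal form. *)
Lemma possemidefmx_sqrt_exists n (M : 'M[R]_n) : possemidefmx M ->
  exists B : 'M[R]_n, possemidefmx B /\ B *m B = M.
Proof.
elim: n M => [|n IHn] M psdM.
  by exists M; split=> //; rewrite flatmx0 [RHS]flatmx0.
have [sM pM] := (possemidefmxP M).1 psdM.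
have [v [l [v1 Mv]]] := sym_eigenvector sM.
have l0 : 0 <= l by have := pM v; rewrite Mv dotvZr v1 mulr1.
pose e0 : 'cV[R]_(1 + n) := col_mx 1%:M 0.
have e01 : dotv e0 e0 = dotv (n := 1 + n) v v.
  by rewrite v1 dotv_col_mx /dotv trmx1 mul1mx mulmx0 !mxE addr0.
have [Q oQ Qe] := orthogonal_map e01.
pose N : 'M[R]_(1 + n) := Q^T *m M *m Q.
have psdN : possemidefmx N by exact: possemidefmx_congr.
have Ne : N *m e0 = l *: e0.
  by rewrite /N -!mulmxA Qe Mv -scalemxAr -Qe mulmxA oQ mul1mx.
have [sN _] := psdN; have NE := sym_block_first sN Ne.
move: (psdN); rewrite NE => /possemidefmx_block[_ /IHn[B [psdB BB]]].
pose C : 'M[R]_(1 + n) := block_mx (Num.sqrt l)%:M 0 0 B.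
have psdC : possemidefmx C.
  apply/possemidefmx_block; split=> //; rewrite -scalemx1.
  exact/possemidefmxZ/possemidefmx1/sqrtr_ge0.
have CC : C *m C = N.
  rewrite mulmx_block !mulmx0 !mul0mx !addr0 !add0r BB NE; congr block_mx.
    by rewrite -scalar_mxM -expr2 sqr_sqrtr.
  by rewrite -NE.
exists (Q *m C *m Q^T); split.
  by rewrite -{1}(trmxK Q); exact: possemidefmx_congr.
rewrite !mulmxA -(mulmxA (Q *m C)) oQ mulmx1 -(mulmxA Q) CC /N !mulmxA.
by rewrite orthogonalmxC// mul1mx -mulmxA orthogonalmxC// mulmx1.
Qed.

Lemma sqrtmx_spec n (M : 'M[R]_n) : possemidefmx M ->
  possemidefmx (sqrtmx M) /\ sqrtmx M *m sqrtmx M = M.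
Proof.
move=> /possemidefmx_sqrt_exists sqrtM; rewrite /sqrtmx.
exact: (xgetPex 0 sqrtM).
Qed.

(** The diagonal entries are values of the quadratic form of [M]. *)
Lemma trace_gram_ge0 m n (X : 'M[R]_(m, n)) (M : 'M[R]_m) : possemidefmx M ->
  0 <= \tr (X^T *m M *m X).
Proof.
move=> psdM; rewrite /mxtrace sumr_ge0// => i _.
have /possemidefmxP[_ /(_ (delta_mx i 0))] := possemidefmx_congr X psdM.
rewrite -colE dotvE (bigD1 i)//= big1 ?addr0 => [|j /negPf ji]; last first.
  by rewrite mxE ji mul0r.
by rewrite !mxE !eqxx mul1r.
Qed.

Lemma trace_mul_ge0 n (M N : 'M[R]_n) :
  possemidefmx M -> possemidefmx N -> 0 <= \tr (M *m N).
Proof.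
move=> psdM /sqrtmx_spec[[sB _] BB]; rewrite -BB mulmxA mxtrace_mulC mulmxA.
by rewrite -{1}sB trace_gram_ge0.
Qed.

Lemma possemidefmx_addI_unit n (M : 'M[R]_n) e : 0 < e -> possemidefmx M ->
  M + e%:M \in unitmx.
Proof.
move=> e0 /possemidefmxP[sM pM].
rewrite -row_free_unit -kermx_eq0; set K := kermx _.
have KM : (M + e%:M) *m K^T = 0.
  by rewrite -[M in LHS]sM -tr_scalar_mx -linearD/= -trmx_mul mulmx_ker trmx0.
suff K0 j : col j K^T = 0.
  by apply/eqP/matrixP => i j; have /colP/(_ j) := K0 i; rewrite !mxE.
apply/eqP; rewrite -dotv_eq0; set v := col j K^T.
have Mv : (M + e%:M) *m v = 0 by rewrite /v colE mulmxA KM mul0mx.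
have := congr1 (dotv v) Mv.
rewrite mulmxDl mul_scalar_mx dotvDr dotvZr {3}/dotv mulmx0 mxE => /eqP.
rewrite paddr_eq0 ?pM ?(mulr_ge0 (ltW e0) (dotv_ge0 v))// => /andP[_].
by rewrite mulf_eq0 gt_eqF.
Qed.

Lemma invmx_sym n (M : 'M[R]_n) : M^T = M -> (invmx M)^T = invmx M.
Proof. by move=> sM; rewrite trmx_inv sM. Qed.

Lemma possemidefmx_inv n (M : 'M[R]_n) : M \in unitmx -> possemidefmx M ->
  possemidefmx (invmx M).
Proof.
move=> uM psdM; have [sM _] := psdM.
have <- : (invmx M)^T *m M *m invmx M = invmx M.
  by rewrite invmx_sym// mulVmx// mul1mx.
exact: possemidefmx_congr.
Qed.

End psd.

(** * The trace of the square root of S T S *)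

Section fidelity.
Context (R : realType).

(** With [D] the square root of [S T S], the left-hand side is at least
    [2 tr D] for all such [P], with equality for [P = S^-1 D S^-1] in the
    invertible case. As [S] and [D] may be singular, the witness is
    [P = F^-1 E F^-1] with [E = D + d] and [F = S + e]. Then
    [tr (P S S) <= tr E], because [F^-1 S S F^-1 <= 1], and [tr (P^-1 T)], which
    is [tr (E^-1 F T F)], equals [tr (E^-1 D D) <= tr D] up to terms in [e] and
    [e^2] whose coefficients depend on [d] only. Hence [d] is chosen first and
    [e] second. *)
Lemma fidelity_dual n (S T D : 'M[R]_n) (eta : R) :
  possemidefmx S -> possemidefmx T -> possemidefmx D ->
  D *m D = S *m T *m S -> 0 < eta ->
  exists P P' : 'M[R]_n, [/\ possemidefmx P, P'^T = P', P *m P' = 1%:M &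
    \tr (P *m (S *m S)) + \tr (P' *m T) <= 2 * \tr D + eta].
Proof.
move=> psdS psdT psdD DD eta0.
have n1 : 0 < (n.+1%:R : R) by rewrite ltr0n.
pose d : R := eta / (2 * n.+1%:R).
have d0 : 0 < d by rewrite divr_gt0// mulr_gt0.
pose E := D + d%:M; pose E' := invmx E.
have uE : E \in unitmx by exact: possemidefmx_addI_unit.
have psdE : possemidefmx E.
  by apply: possemidefmxD => //; rewrite -scalemx1; exact/possemidefmxZ/possemidefmx1/ltW.
have psdE' : possemidefmx E' by exact: possemidefmx_inv.
pose c1 := \tr (E' *m (S *m T + T *m S)); pose c2 := \tr (E' *m T).
pose x := `|c1| + `|c2|.
have x0 : 0 <= x by rewrite addr_ge0.
(* Chosen so that both [e <= 1] and [e x <= eta / 2]. *)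
pose e := eta / (2 * x + 2 + eta).
have den0 : 0 < 2 * x + 2 + eta by lra.
have e0 : 0 < e by rewrite divr_gt0.
have e1 : e <= 1 by rewrite ler_pdivrMr// mul1r; lra.
have ex : e * x <= eta / 2.
  rewrite /e mulrAC ler_pdivrMr//; nra.
pose F := S + e%:M; pose F' := invmx F.
have uF : F \in unitmx by exact: possemidefmx_addI_unit.
have psdF : possemidefmx F.
  by apply: possemidefmxD => //; rewrite -scalemx1; exact/possemidefmxZ/possemidefmx1/ltW.
have [[[sF _] [sE _]] [sE' _]] := (psdF, psdE, psdE').
have sF' : F'^T = F' by exact: invmx_sym.
exists (F' *m E *m F'), (F *m E' *m F); split.
- by rewrite -{1}sF'; exact: possemidefmx_congr.
- by rewrite !trmx_mul sF sE' mulmxA.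
- rewrite -!mulmxA (mulmxA F' F) mulVmx// mul1mx (mulmxA E) mulmxV// mul1mx.
  by rewrite mulVmx.
have FE : F = S + e *: 1%:M by rewrite scalemx1.
have bndS : \tr (F' *m E *m F' *m (S *m S)) <= \tr E.
  have -> : \tr E = \tr (E *m (F' *m (F *m F) *m F')).
    by rewrite (mulmxA F' F F) mulVmx// mul1mx mulmxV// mulmx1.
  have -> : \tr (F' *m E *m F' *m (S *m S)) = \tr (E *m (F' *m (S *m S) *m F')).
    by rewrite -!mulmxA mxtrace_mulC -!mulmxA.
  rewrite -subr_ge0 -linearB/= -mulmxBr -mulmxBl -mulmxBr trace_mul_ge0//.
  rewrite -{1}sF'; apply: possemidefmx_congr.
  have -> : F *m F - S *m S = (2 * e) *: S + (e * e) *: 1%:M.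
    rewrite FE mulmxDl !mulmxDr -!scalemxAl -!scalemxAr !mul1mx mulmx1 scalerA.
    by rewrite mulr2n mulrDl mul1r scalerDl [LHS]addrC -!addrA addKr.
  apply: possemidefmxD; apply: possemidefmxZ => //.
  - by rewrite mulr_ge0// ltW.
  - by rewrite mulr_ge0// ltW.
  - exact: possemidefmx1.
have bndT : \tr (F *m E' *m F *m T) <= \tr D + e * c1 + e ^+ 2 * c2.
  have -> : \tr (F *m E' *m F *m T) = \tr (E' *m (F *m T *m F)).
    by rewrite -!mulmxA mxtrace_mulC -!mulmxA.
  have -> : F *m T *m F = D *m D + e *: (S *m T + T *m S) + (e ^+ 2) *: T.
    rewrite DD FE !(mulmxDl, mulmxDr) -!scalemxAl -!scalemxAr !(mul1mx, mulmx1).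
    by rewrite scalerA -expr2 scalerDr !addrA; congr (_ + _); rewrite addrAC.
  have -> : \tr (E' *m (D *m D + e *: (S *m T + T *m S) + e ^+ 2 *: T)) =
      \tr (E' *m (D *m D)) + e * c1 + e ^+ 2 * c2.
    rewrite /c1 /c2 !mulmxDr !linearD/= -!scalemxAr !linearZ/=.
    by rewrite ?linearD /= ?mulrDr.
  rewrite !lerD2r -subr_ge0 -linearB/=.
  have -> : D - E' *m (D *m D) = d *: (E' *m D).
    rewrite -{1}(mulKmx uE D) -/E' -mulmxBr /E mulmxDl addrAC addrN add0r.
    by rewrite mul_scalar_mx scalemxAr.
  by rewrite linearZ/= mulr_ge0 ?(ltW d0)// trace_mul_ge0.
have trE : \tr E <= \tr D + eta / 2.
  rewrite linearD/= lerD2l mxtrace_scalar -[d *+ n]mulr_natr.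
  have -> : eta / 2 = d * n.+1%:R.
    by rewrite /d invfM mulrA divfK// gt_eqF.
  by rewrite ler_wpM2l ?(ltW d0)// ler_nat.
have ec1 : e * c1 <= e * `|c1| by rewrite ler_wpM2l ?ler_norm// ltW.
have ec2 : e ^+ 2 * c2 <= e * `|c2|.
  apply: (@le_trans _ _ (e ^+ 2 * `|c2|)).
    by rewrite ler_wpM2l ?ler_norm// sqr_ge0.
  by rewrite expr2 -mulrA ler_wpM2l ?(ltW e0)// ler_piMl.
move: ex bndS bndT trE; rewrite /x; lra.
Qed.

(** Polar decompositions [X^T = Q1 S] and [Y^T S = Q2 D] turn the trace into
    that of [Q1 D Q2^T Q], and [Q = Q2 Q1^T] leaves the trace of [D]. *)
Lemma fidelity_attained n (S D X Y : 'M[R]_n) :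
  S^T = S -> D^T = D -> X *m X^T = S *m S -> D *m D = S *m (Y *m Y^T) *m S ->
  exists2 Q, orthogonalmx Q & \tr (X^T *m Y *m Q) = \tr D.
Proof.
move=> sS sD XX DD.
have /gram_orthogonal[Q1 oQ1 Q1E] : S^T *m S = (X^T)^T *m X^T.
  by rewrite trmxK sS XX.
have /gram_orthogonal[Q2 oQ2 Q2E] : D^T *m D = (Y^T *m S)^T *m (Y^T *m S).
  by rewrite trmx_mul trmxK sS sD DD !mulmxA.
exists (Q2 *m Q1^T); first exact/orthogonalmxM/orthogonalmxT.
have YE : S *m Y = D *m Q2^T.
  by apply: trmx_inj; rewrite !trmx_mul trmxK sS sD Q2E.
rewrite -Q1E -(mulmxA Q1) YE -!mulmxA (mulmxA Q2^T) oQ2 mul1mx mxtrace_mulC.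
by rewrite -mulmxA oQ1 mulmx1.
Qed.

End fidelity.

(** * Integrals against Lebesgue measure and the normal law *)

Section one_dim.
Context (R : realType).
Local Notation lambda := (@lebesgue_measure R).

(** The density is the Radon-Nikodym derivative up to a null set. *)
Lemma ge0_integral_normal_prob (m s : R) (f : measurableTypeR R -> \bar R) :
  measurable_fun setT f -> (forall x, (0 <= f x)%E) ->
  (\int[normal_prob m s]_x f x =
   \int[lambda]_x (f x * (normal_pdf m s x)%:E))%E.
Proof.
move=> mf f0; have dom := normal_prob_dominates m s.
rewrite -(Radon_Nikodym_SigmaFinite.change_of_variables dom f0 measurableT mf).
have mpdf : measurable_fun setT (fun x => (normal_pdf m s x)%:E).
  by apply/measurable_EFinP; exact: measurable_normal_pdf.
apply: ae_eq_integral => //.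
- apply: emeasurable_funM => //.
  exact: measurable_int (Radon_Nikodym_SigmaFinite.f_integrable dom).
- exact: emeasurable_funM.
- apply: ae_eqe_mul2l; apply: integral_ae_eq => //.
  + exact: Radon_Nikodym_SigmaFinite.f_integrable.
  + by move=> E _ mE; rewrite -(Radon_Nikodym_SigmaFinite.f_integral dom).
Qed.

(** Lebesgue measure is determined by its values on half-open intervals. For
    negative [a] the preimage of such an interval is half-open on the other
    side, with the same length. *)
Lemma lebesgue_measure_affine (a b : R) (A : set (measurableTypeR R)) :
  a != 0 -> measurable A ->
  (`|a|%:E * lambda ((fun x => a * x + b)%R @^-1` A))%E = lambda A.
Proof.
move=> a0 mA.
pose h : measurableTypeR R -> measurableTypeR R := fun x => a * x + b.
have mh : measurable_fun setT h.
  by apply: measurable_funD => //; exact: measurable_funM.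
pose k : {nonneg R} := NngNum (normr_ge0 a).
have /(_ mh) uniq := @lebesgue_measure_unique R (mscale k (pushforward lambda h)).
apply/esym/uniq => // _ [[p q]] _ <-.
rewrite lebesgue_measure_itv/= lte_fin.
rewrite [RHS](_ : _ = `|a|%:E * lambda (h @^-1` `]p, q]))%E//.
have [a_lt0|a_gt0|/eqP] := ltrgtP a 0; last by rewrite (negbTE a0).
  have -> : h @^-1` `]p, q] = `[(q - b) / a, (p - b) / a[%classic.
    apply/seteqP; split=> x; rewrite /= !in_itv/= ler_ndivrMr// ltr_ndivlMr//;
      by rewrite lerBrDr ltrBlDr (mulrC x) andbC.
  rewrite lebesgue_measure_itv/= lte_fin ltr_nM2r ?invr_lt0// ltrD2r.
  case: ifPn => _; last by rewrite mule0.
  rewrite -!EFinD -EFinM; congr (_%:E).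
  by rewrite ltr0_norm//; field.
have -> : h @^-1` `]p, q] = `](p - b) / a, (q - b) / a]%classic.
  apply/seteqP; split=> x; rewrite /= !in_itv/= ltr_pdivrMr// ler_pdivlMr//;
    by rewrite lerBrDr ltrBlDr (mulrC x).
rewrite lebesgue_measure_itv/= lte_fin ltr_pM2r ?invr_gt0// ltrD2r.
case: ifPn => _; last by rewrite mule0.
rewrite -!EFinD -EFinM; congr (_%:E).
by rewrite gtr0_norm//; field.
Qed.

Lemma ge0_integral_affine (a b : R) (f : measurableTypeR R -> \bar R) :
  a != 0 -> measurable_fun setT f -> (forall x, (0 <= f x)%E) ->
  (`|a|%:E * \int[lambda]_x f (a * x + b)%R = \int[lambda]_x f x)%E.
Proof.
move=> a0 mf f0.
pose h : measurableTypeR R -> measurableTypeR R := fun x => a * x + b.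
have mh : measurable_fun setT h.
  by apply: measurable_funD => //; exact: measurable_funM.
pose k : {nonneg R} := NngNum (normr_ge0 a).
pose nu := mscale k (pushforward lambda h)
  : {measure set (measurableTypeR R) -> \bar R}.
transitivity (\int[nu mh]_x f x)%E.
  by rewrite ge0_integral_mscale// ge0_integral_pushforward.
apply: eq_measure_integral => A mA _.
exact: lebesgue_measure_affine.
Qed.

End one_dim.

Section second_moment.
Context (R : realType).
Local Notation lambda := (@lebesgue_measure R).
Local Notation phi := (@normal_pdf R 0 1).

Lemma normal_pdf01E x : phi x = normal_peak 1 * expR (- (x ^+ 2 / 2)).
Proof.
by rewrite normal_pdfE ?oner_neq0// /normal_fun subr0 expr1n mulNr.
Qed.

Lemma normal_pdf01_even x : phi (- x) = phi x.
Proof. by rewrite !normal_pdf01E sqrrN. Qed.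

Lemma is_derive_normal_pdf01 (x : R) :
  is_derive x 1 (fun y => - phi y) (x * phi x).
Proof.
rewrite (_ : (fun y => _) =
    fun y : R => - (normal_peak 1 * expR (- (y ^+ 2 / 2)))); last first.
  by apply/funext => y; rewrite normal_pdf01E.
rewrite normal_pdf01E.
apply: is_derive_eq.
by rewrite /GRing.scale/=; field.
Qed.

Lemma cvg_normal_pdf01 : - phi x @[x --> +oo] --> 0.
Proof.
rewrite -[X in _ --> X]oppr0; apply: cvgN.
apply: (@squeeze_cvgr _ _ _ _ (cst 0) (fun x : R => normal_peak 1 * expR (- x))).
- near=> x; rewrite normal_pdf_ge0/= normal_pdf01E.
  rewrite ler_wpM2l ?normal_peak_ge0// ler_expR lerN2.
  have : 2 <= x by near: x; exact: nbhs_pinfty_ge.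
  nra.
- exact: cvg_cst.
- rewrite -(mulr0 (normal_peak 1)); apply: cvgM; first exact: cvg_cst.
  exact: cvgr_expR.
Unshelve. all: by end_near. Qed.


(** The density of [N(0, 1)] satisfies [phi'(t) = - t phi(t)] and vanishes at
    infinity. *)
Lemma integral_tail_normal_pdf01 (x : R) : 0 <= x ->
  (\int[lambda]_(t in `[x, +oo[) (t * phi t)%:E = (phi x)%:E)%E.
Proof.
move=> x0; rewrite (@ge0_continuous_FTC2y _ _ (fun y => - phi y) _ 0).
- by rewrite sub0e -EFinN opprK.
- by move=> t xt; rewrite mulr_ge0 ?normal_pdf_ge0// (le_trans x0).
- apply: continuous_subspaceT => t; apply: cvgM; first exact: cvg_id.
  by apply: continuous_normal_pdf; rewrite oner_neq0.
- exact: cvg_normal_pdf01.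
- by move=> t _; have [] := is_derive_normal_pdf01 t.
- apply: cvg_at_right_filter; apply: cvgN.
  by apply: continuous_normal_pdf; rewrite oner_neq0.
- by move=> t _; rewrite derive1E; have [] := is_derive_normal_pdf01 t.
Qed.

(** Integrate [t phi(t)] over the region [0 <= x <= t] in both orders: the
    inner integral over [x] gives [t^2 phi(t)], that over [t] gives [phi(x)]. *)
Lemma half_second_moment :
  (\int[lambda]_(t in `[0%R, +oo[) (t ^+ 2 * phi t)%:E =
   \int[lambda]_(x in `[0%R, +oo[) (phi x)%:E)%E.
Proof.
pose J : set R := `[0, +oo[%classic.
(* The absolute value makes [K] nonnegative everywhere without changing it
   where the indicators are nonzero. *)
pose K (z : measurableTypeR R * measurableTypeR R) : \bar R :=
  ((`|z.2| * phi z.2) * (\1_J z.1 * \1_J (z.2 - z.1)))%:E.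
have mphi : measurable_fun setT phi by exact: measurable_normal_pdf.
have mK : measurable_fun setT K.
  apply/measurable_EFinP; apply: measurable_funM.
    apply: measurable_funM; first exact: measurableT_comp.
    exact: measurableT_comp.
  have mJ : measurable_fun setT (\1_J : measurableTypeR R -> R).
    by apply: measurable_indic; exact: measurable_itv.
  apply: measurable_funM; first exact: (measurableT_comp mJ measurable_fst).
  apply: (measurableT_comp mJ); exact: measurable_funB.
have K0 z : (0 <= K z)%E.
  by rewrite lee_fin !mulr_ge0// normal_pdf_ge0.
transitivity (\int[lambda]_t \int[lambda]_x K (x, t))%E.
  rewrite integral_mkcond; apply: eq_integral => t _; rewrite patchE.
  have -> : (\int[lambda]_x K (x, t) =
      (`|t| * phi t)%:E * \int[lambda]_x (\1_(`[0%R, t]) x)%:E)%E.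
    rewrite -ge0_integralZl//=; last 2 first.
    - by apply/measurable_EFinP; exact: measurable_indic.
    - by rewrite lee_fin mulr_ge0// normal_pdf_ge0.
    apply: eq_integral => x _; rewrite /K/= -EFinM; congr (_ * _)%:E.
    rewrite !indicE /J !mem_setE !in_itv/= !andbT subr_ge0.
    by case: (0 <= x); case: (x <= t); rewrite ?mulr1 ?mulr0 ?mul1r.
  rewrite integral_indic//= setIT lebesgue_measure_itv/= lte_fin.
  rewrite mem_setE in_itv/= andbT le_eqVlt.
  have [t0|t0|<-] := ltrgtP 0 t.
  - by rewrite orbT oppr0 adde0 -EFinM gtr0_norm// expr2 mulrAC.
  - by rewrite mule0.
  - by rewrite expr2 !mul0r mule0.
rewrite -fubini_tonelli//.
rewrite [RHS]integral_mkcond; apply: eq_integral => x _; rewrite patchE mem_setE.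
case: ifPn => [x0|x0].
  rewrite -integral_tail_normal_pdf01; last by move: x0; rewrite in_itv/= andbT.
  rewrite [RHS]integral_mkcond; apply: eq_integral => t _; rewrite patchE mem_setE.
  rewrite /K/= !indicE !mem_setE x0 mul1r !in_itv/= !andbT subr_ge0.
  move: x0; rewrite in_itv/= andbT => x0.
  case: ifPn => xt; last by rewrite mulr0.
  by rewrite mulr1 ger0_norm// (le_trans x0).
apply: integral0_eq => t _; rewrite /K/= !indicE mem_setE (negPf x0).
by rewrite mul0r mulr0.
Qed.

Lemma normal_prob01_second_moment :
  (\int[normal_prob 0 1]_x ((x : R) ^+ 2)%:E = 1)%E.
Proof.
rewrite ge0_integral_normal_prob; last 2 first.
- by apply/measurable_EFinP; exact: measurable_funX.
- by move=> x; rewrite lee_fin sqr_ge0.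
have cphi : continuous phi by apply: continuous_normal_pdf; rewrite oner_neq0.
under eq_integral do rewrite -EFinM.
rewrite (@ge0_symfun_integralT R (fun x => x ^+ 2 * phi x)).
- rewrite -set_itvcy half_second_moment -(@integral_normal_pdf R 0 1).
  rewrite (@ge0_symfun_integralT R phi) ?set_itvcy//.
  + by move=> x; exact: normal_pdf_ge0.
  + by move=> x/=; rewrite normal_pdf01_even.
- by move=> x; rewrite mulr_ge0 ?sqr_ge0 ?normal_pdf_ge0.
- by move=> x; apply: cvgM; [exact: exprn_continuous|exact: cphi].
- by move=> x/=; rewrite sqrrN normal_pdf01_even.
Qed.

End second_moment.

(** * Rotation invariance of the standard Gaussian *)

Section planar.
Context (R : realType).
Local Notation lambda := (@lebesgue_measure R).
Local Notation phi := (@normal_pdf R 0 1).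
Local Notation T := (measurableTypeR R).
Local Open Scope ereal_scope.

Lemma ge0_integral_comp_affine (a b : R) (f : T -> \bar R) :
  (a != 0)%R -> measurable_fun setT f -> (forall x, 0 <= f x) ->
  \int[lambda]_x f (a * x + b)%R = (`|a|^-1)%:E * \int[lambda]_x f x.
Proof.
move=> a0 mf f0; rewrite -(ge0_integral_affine b a0 mf f0) muleA -EFinM.
by rewrite mulVf ?normr_eq0// mul1e.
Qed.

(** The product density depends on [x^2 + y^2] only. *)
Lemma normal_pdf01_rotate (c s x y : R) : (c ^+ 2 + s ^+ 2 = 1)%R ->
  (phi (c * x - s * y) * phi (s * x + c * y) = phi x * phi y)%R.
Proof.
move=> cs; rewrite !normal_pdfE ?oner_neq0// /normal_fun !subr0 mulrACA -expRD.
rewrite [RHS]mulrACA -expRD; congr (_ * expR _)%R.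
rewrite -!mulrDl -!opprD; congr (- _ / _)%R.
transitivity ((c ^+ 2 + s ^+ 2) * (x ^+ 2 + y ^+ 2))%R; first by ring.
by rewrite cs mul1r.
Qed.

Lemma integral_normal2 (h : T * T -> \bar R) :
  measurable_fun setT h -> (forall z, 0 <= h z) ->
  \int[normal_prob 0 1]_x \int[normal_prob 0 1]_y h (x, y) =
  \int[lambda]_x \int[lambda]_y (h (x, y) * (phi x * phi y)%:E).
Proof.
move=> mh h0.
have mphi : measurable_fun setT (fun x : T => (phi x)%:E).
  by apply/measurable_EFinP; exact: measurable_normal_pdf.
rewrite ge0_integral_normal_prob; last 2 first.
- exact: (measurable_fun_fubini_tonelli_F h).
- by move=> x; exact: integral_ge0.
apply: eq_integral => x _; rewrite ge0_integral_normal_prob//; last first.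
  exact: measurableT_comp.
rewrite muleC -ge0_integralZl//=; last 3 first.
- by apply: emeasurable_funM => //; exact: measurableT_comp.
- by move=> y _; rewrite mule_ge0// lee_fin normal_pdf_ge0.
- by rewrite lee_fin normal_pdf_ge0.
by apply: eq_integral => y _; rewrite muleCA EFinM.
Qed.

Lemma lebesgue_swap (H : T * T -> \bar R) :
  measurable_fun setT H -> (forall z, 0 <= H z) ->
  \int[lambda]_x \int[lambda]_y H (x, y) = \int[lambda]_y \int[lambda]_x H (x, y).
Proof. exact: fubini_tonelli. Qed.

(** After absorbing the rotation-invariant density into the integrand [H], the
    rotation is undone by two affine substitutions in one variable at a time:
    [u = c x - s y] at fixed [y], then [v = (y + s u) / c] at fixed [u]. Their
    Jacobians [|c|^-1] and [|c|] cancel. *)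
Lemma normal2_rotate_neq0 (c s : R) (h : T * T -> \bar R) :
  (c ^+ 2 + s ^+ 2 = 1)%R -> (c != 0)%R ->
  measurable_fun setT h -> (forall z, 0 <= h z) ->
  \int[normal_prob 0 1]_x \int[normal_prob 0 1]_y
     h (c * x - s * y, s * x + c * y)%R =
  \int[normal_prob 0 1]_x \int[normal_prob 0 1]_y h (x, y).
Proof.
move=> cs c0 mh h0.
pose H (z : T * T) := h z * (phi z.1 * phi z.2)%:E.
have mH : measurable_fun setT H.
  apply: emeasurable_funM => //; apply/measurable_EFinP.
  by apply: measurable_funM; (apply: measurableT_comp => //; exact: measurable_normal_pdf).
have H0 z : 0 <= H z.
  by rewrite mule_ge0// lee_fin mulr_ge0// normal_pdf_ge0.
have mlin (a b a' b' : R) : measurable_fun setT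
    (fun z : T * T => (a * z.1 + b * z.2, a' * z.1 + b' * z.2)%R : T * T).
  by apply/measurable_fun_pair; apply: measurable_funD; apply: measurable_funM.
have mHl (a b a' b' : R) : measurable_fun setT
    (fun z : T * T => H (a * z.1 + b * z.2, a' * z.1 + b' * z.2)%R).
  exact: (measurableT_comp mH (mlin a b a' b')).
pose hr (z : T * T) := h (c * z.1 - s * z.2, s * z.1 + c * z.2)%R.
have mhr : measurable_fun setT hr.
  rewrite (_ : hr = fun z : T * T => h (c * z.1 + - s * z.2, s * z.1 + c * z.2)%R).
    exact: (measurableT_comp mh (mlin c (- s)%R s c)).
  by apply/funext => z; rewrite /hr mulNr.
pose H1 (z : T * T) := H (c * z.1 - s * z.2, s * z.1 + c * z.2)%R.
have mH1 : measurable_fun setT H1.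
  rewrite (_ : H1 = fun z : T * T => H (c * z.1 + - s * z.2, s * z.1 + c * z.2)%R).
    exact: mHl.
  by apply/funext => z; rewrite /H1 mulNr.
pose H2 (z : T * T) := H (z.2, c^-1 * z.1 + c^-1 * s * z.2)%R.
have mH2 : measurable_fun setT H2.
  rewrite (_ : H2 = fun z : T * T =>
      H (0 * z.1 + 1 * z.2, c^-1 * z.1 + c^-1 * s * z.2)%R).
    exact: mHl.
  by apply/funext => z; rewrite /H2 mul0r add0r mul1r.
have H20 z : 0 <= H2 z by exact: H0.
rewrite (integral_normal2 mh h0) (integral_normal2 mhr (fun z => h0 _)).
transitivity (\int[lambda]_x \int[lambda]_y H1 (x, y)).
  apply: eq_integral => x _; apply: eq_integral => y _.
  by rewrite /H1/H/= normal_pdf01_rotate.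
transitivity (\int[lambda]_y \int[lambda]_x H1 (x, y)).
  exact: (lebesgue_swap mH1 (fun z => H0 _)).
transitivity (\int[lambda]_y ((`|c|^-1)%:E * \int[lambda]_u H2 (y, u))).
  apply: eq_integral => y _.
  have mH2y : measurable_fun setT (fun u => H2 (y, u)).
    exact: (measurableT_comp mH2 (measurable_pair1 y)).
  rewrite -(ge0_integral_comp_affine (- (s * y))%R c0 mH2y (fun u => H20 _)).
  apply: eq_integral => x _; rewrite /H1 /H2 /=; congr (H (_, _)).
  transitivity ((s * x * c + (c ^+ 2 + s ^+ 2) * y - s ^+ 2 * y) / c)%R.
    by field.
  by rewrite cs; field.
rewrite ge0_integralZl; last 4 first.
- exact: measurableT.
- exact: (measurable_fun_fubini_tonelli_F H2 mH2).
- by move=> y _; apply: integral_ge0 => u _; exact: H20.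
- by rewrite lee_fin invr_ge0.
transitivity ((`|c|^-1)%:E * \int[lambda]_u \int[lambda]_y H2 (y, u)).
  apply: (congr1 (fun t => (`|c|^-1)%:E * t)).
  exact: (lebesgue_swap mH2 H20).
transitivity ((`|c|^-1)%:E * \int[lambda]_u ((`|c|)%:E * \int[lambda]_v H (u, v))).
  apply: (congr1 (fun t => (`|c|^-1)%:E * t)); apply: eq_integral => u _.
  have mHu : measurable_fun setT (fun v => H (u, v)).
    exact: (measurableT_comp mH (measurable_pair1 u)).
  have c'0 : (c^-1 != 0)%R by rewrite invr_eq0.
  have := ge0_integral_comp_affine (c^-1 * s * u)%R c'0 mHu (fun v => H0 _).
  by rewrite normfV invrK.
rewrite ge0_integralZl; last 4 first.
- exact: measurableT.
- exact: (measurable_fun_fubini_tonelli_F H mH).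
- by move=> y _; apply: integral_ge0 => u _; exact: H0.
- by rewrite lee_fin.
by rewrite muleA -EFinM mulVf ?normr_eq0// mul1e.
Qed.

(** A quarter turn is the composite of two rotations with nonzero cosines; the
    3-4-5 triangle provides the first one. *)
Lemma normal2_rotate (c s : R) (h : T * T -> \bar R) :
  (c ^+ 2 + s ^+ 2 = 1)%R ->
  measurable_fun setT h -> (forall z, 0 <= h z) ->
  \int[normal_prob 0 1]_x \int[normal_prob 0 1]_y
     h (c * x - s * y, s * x + c * y)%R =
  \int[normal_prob 0 1]_x \int[normal_prob 0 1]_y h (x, y).
Proof.
move=> cs mh h0; have [c0|c0] := eqVneq c 0%R; last exact: (normal2_rotate_neq0 cs c0 mh h0).
have s0 : (s != 0)%R.
  by apply/eqP => s0; move: cs; rewrite c0 s0 expr0n addr0 => /eqP; rewrite eq_sym oner_eq0.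
have ss : (s ^+ 2 = 1)%R by rewrite -cs c0 expr0n add0r.
pose c' : R := (4 / 5 * s)%R; pose s' : R := (3 / 5 * s)%R.
have cs' : (c' ^+ 2 + s' ^+ 2 = 1)%R.
  by rewrite /c' /s' !exprMn ss; field.
have c'0 : (c' != 0)%R by rewrite mulf_neq0.
pose h' (z : T * T) := h (c' * z.1 - s' * z.2, s' * z.1 + c' * z.2)%R.
have mh' : measurable_fun setT h'.
  apply: (measurableT_comp mh); apply/measurable_fun_pair.
    by apply: measurable_funB; apply: measurable_funM.
  by apply: measurable_funD; apply: measurable_funM.
have e35 : ((3 / 5) ^+ 2 + (4 / 5) ^+ 2 = 1 :> R)%R by field.
have n35 : (3 / 5 != 0 :> R)%R by rewrite mulf_neq0.
rewrite -(normal2_rotate_neq0 cs' c'0 mh h0).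
rewrite -(normal2_rotate_neq0 (h := h') e35 n35 mh' (fun z => h0 _)).
apply: eq_integral => x _; apply: eq_integral => y _; rewrite /h' /=.
by congr (h (_, _)); rewrite /c' /s' c0; field.
Qed.

Lemma normal_opp (f : T -> \bar R) :
  measurable_fun setT f -> (forall x, 0 <= f x) ->
  \int[normal_prob 0 1]_x f (- x)%R = \int[normal_prob 0 1]_x f x.
Proof.
move=> mf f0.
have mphi : measurable_fun setT (fun x : T => (phi x)%:E).
  by apply/measurable_EFinP; exact: measurable_normal_pdf.
have mo : measurable_fun setT (fun x : T => (- x)%R : T) by exact: measurableT_comp.
rewrite ge0_integral_normal_prob//; last exact: (measurableT_comp mf mo).
rewrite ge0_integral_normal_prob//.
pose g (x : T) := f x * (phi x)%:E.
have mg : measurable_fun setT g by exact: emeasurable_funM.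
have g0 x : 0 <= g x by rewrite mule_ge0// lee_fin normal_pdf_ge0.
have n10 : (-1 != 0 :> R)%R by rewrite oppr_eq0 oner_eq0.
have := ge0_integral_comp_affine 0%R n10 mg g0.
rewrite normrN1 invr1 mul1e => <-; apply: eq_integral => x _.
rewrite /g addr0 mulN1r; congr (_ * _%:E).
by rewrite !normal_pdfE ?oner_neq0// /normal_fun !subr0 sqrrN.
Qed.

End planar.

Section tuples.
Context (R : realType).

Definition col_tuple n (z : n.-tuple R) : 'cV[R]_n := \col_i tnth z i.

Lemma col_tuple_inj n : injective (@col_tuple n).
Proof.
move=> z z' /colP zz'; apply: eq_from_tnth => i.
by have := zz' i; rewrite !mxE.
Qed.

Lemma col_tuple_cons n x (w : n.-tuple R) :
  col_tuple (cons_tuple_pair (x, w)) = col_mx x%:M (col_tuple w) :> 'cV_(1 + n).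
Proof.
apply/colP => i; case: (split_ordP i) => j ->.
  rewrite col_mxEu !mxE (_ : (lshift n j : 'I_n.+1) = ord0) ?ord1 ?eqxx//.
  by apply: val_inj; case: j => -[].
rewrite col_mxEd !mxE (_ : (rshift 1 j : 'I_n.+1) = lift ord0 j) ?tnthS//.
exact: val_inj.
Qed.

Definition mul_tuple n (Q : 'M[R]_n) (z : n.-tuple R) : n.-tuple R :=
  [tuple (Q *m col_tuple z) i 0 | i < n].

Lemma col_mul_tuple n (Q : 'M[R]_n) z :
  col_tuple (mul_tuple Q z) = Q *m col_tuple z.
Proof. by apply/colP => i; rewrite !mxE tnth_mktuple !mxE. Qed.

Lemma mul_tupleM n (P Q : 'M[R]_n) z :
  mul_tuple (P *m Q) z = mul_tuple P (mul_tuple Q z).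
Proof. by apply: col_tuple_inj; rewrite !col_mul_tuple mulmxA. Qed.

Lemma measurable_mul_tuple n (Q : 'M[R]_n) : measurable_fun setT (mul_tuple Q).
Proof.
apply/measurable_fun_tnthP => i.
rewrite (_ : _ \o _ = fun z => \sum_j Q i j * tnth z j); last first.
  apply/funext => z /=; rewrite tnth_mktuple mxE.
  by apply: eq_bigr => j _; rewrite mxE.
apply: measurable_sum => j; apply: measurable_funM => //.
exact: measurable_tnth.
Qed.

End tuples.

Section std_gaussian_integral.
Context (R : realType).
Local Notation T := (measurableTypeR R).
Local Open Scope ereal_scope.

Lemma measurable_section_std n (f : n.+1.-tuple R -> \bar R) :
  measurable_fun setT f -> (forall z, 0 <= f z) ->
  measurable_fun setT (fun x : T =>
     \int[std_gaussian R n]_w f (cons_tuple_pair (x, w))).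
Proof.
move=> mf f0.
exact: (measurable_fun_fubini_tonelli_F (fun z => f (cons_tuple_pair z))
  (measurableT_comp mf (@measurable_cons_tuple_pair R n)) (fun z => f0 _)).
Qed.

Lemma ge0_integral_std_gaussianS n (f : n.+1.-tuple R -> \bar R) :
  measurable_fun setT f -> (forall z, 0 <= f z) ->
  \int[std_gaussian R n.+1]_z f z =
  \int[normal_prob 0 1]_x \int[std_gaussian R n]_w f (cons_tuple_pair (x, w)).
Proof.
move=> mf f0.
have mfc : measurable_fun setT (fun z => f (@cons_tuple_pair R n z)).
  exact: (measurableT_comp mf (@measurable_cons_tuple_pair R n)).
transitivity (\int[(normal_prob 0 1 \x std_gaussian R n)]_z f (cons_tuple_pair z)).
  exact: (@ge0_integral_distribution _ _ _ _ _ _ (@cons_tuple_pair R n) f mf f0).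
exact: (fubini_tonelli1 (fun z => f (cons_tuple_pair z)) mfc (fun z => f0 _)).
Qed.

End std_gaussian_integral.

Lemma dotv_scalar (R : realType) (x y : R) :
  dotv (x%:M : 'cV_1) (y%:M : 'cV_1) = x * y.
Proof. by rewrite dotvE big_ord1 !mxE eqxx. Qed.

Lemma dotv0l (R : realType) n (v : 'cV[R]_n) : dotv 0 v = 0.
Proof. by rewrite /dotv trmx0 mul0mx mxE. Qed.

Section planar_matrix.
Context (R : realType) (n : nat).

Definition planar_rotation (c s : R) : 'M[R]_(1 + (1 + n)) :=
  block_mx c%:M (row_mx (- s)%:M 0) (col_mx s%:M 0) (block_mx c%:M 0 0 1%:M).

Lemma planar_rotationE c s x y (w : 'cV[R]_n) :
  planar_rotation c s *m col_mx x%:M (col_mx y%:M w) =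
  col_mx (c * x - s * y)%:M (col_mx (s * x + c * y)%:M w).
Proof.
rewrite mul_block_col mul_row_col mul_col_mx mul_block_col add_col_mx.
by rewrite !mul0mx mul1mx !addr0 !add0r -!scalar_mxM -!raddfD/= mulNr.
Qed.

Lemma planar_rotationT c s :
  (planar_rotation c s)^T = planar_rotation c (- s).
Proof.
rewrite /planar_rotation tr_block_mx tr_row_mx tr_col_mx tr_block_mx opprK.
by rewrite !tr_scalar_mx !trmx0.
Qed.

(** Checked on vectors, where planar_rotationE applies. *)
Lemma planar_rotation_orthogonal c s : c ^+ 2 + s ^+ 2 = 1 ->
  orthogonalmx (planar_rotation c s).
Proof.
move=> cs; rewrite /orthogonalmx planar_rotationT; apply: trmx_inj; apply/row_matrixP => j.
rewrite -!tr_col !colE mul1mx -mulmxA; congr (_^T); move: (delta_mx _ _) => v.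
rewrite -(vsubmxK v) -(vsubmxK (dsubmx v)) [usubmx v]mx11_scalar.
rewrite [usubmx (dsubmx v)]mx11_scalar !planar_rotationE.
set x := _ 0 0; set y := _ 0 0.
by congr col_mx; [|congr col_mx]; congr (_%:M);
  [rewrite -[RHS]mul1r|rewrite -[RHS]mul1r]; rewrite -cs; ring.
Qed.

End planar_matrix.

Section rotation_invariance.
Context (R : realType).
Local Notation T := (measurableTypeR R).

(** Invariance of the law under [Q], stated through integrals of nonnegative
    functions so that it combines with iterated integrals. *)
Definition gaussian_invariant n (Q : 'M[R]_n) : Prop :=
  forall f : n.-tuple R -> \bar R,
    measurable_fun setT f -> (forall z, (0 <= f z)%E) ->
    (\int[std_gaussian R n]_z f (mul_tuple Q z) =
     \int[std_gaussian R n]_z f z)%E.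

Lemma gaussian_invariantM n (P Q : 'M[R]_n) :
  gaussian_invariant P -> gaussian_invariant Q -> gaussian_invariant (P *m Q).
Proof.
move=> iP iQ f mf f0; rewrite -(iP f mf f0).
rewrite -(iQ _ (measurableT_comp mf (measurable_mul_tuple P)) (fun z => f0 _)).
by apply: eq_integral => z _; rewrite mul_tupleM.
Qed.

Lemma gaussian_invariant_block n (Q : 'M[R]_n) : gaussian_invariant Q ->
  gaussian_invariant (block_mx 1%:M 0 0 Q : 'M[R]_(1 + n)).
Proof.
move=> iQ f mf f0; set B := block_mx _ _ _ _.
rewrite (ge0_integral_std_gaussianS mf f0).
rewrite (ge0_integral_std_gaussianS
  (measurableT_comp mf (measurable_mul_tuple B)) (fun z => f0 _)).
apply: eq_integral => x _.
pose g w := f (cons_tuple_pair (x, w)).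
have mg : measurable_fun setT g.
  exact: (measurableT_comp (measurableT_comp mf (@measurable_cons_tuple_pair R n))
    (measurable_pair1 x)).
rewrite -(iQ g mg (fun w => f0 _)); apply: eq_integral => w _; rewrite /g /=.
congr f; apply: col_tuple_inj; rewrite col_mul_tuple !col_tuple_cons.
by rewrite mul_block_col !mul0mx mul1mx addr0 add0r col_mul_tuple.
Qed.

(** Integrating out the coordinates after the second leaves a function on the
    plane, to which normal2_rotate applies. *)
Lemma gaussian_invariant_planar n (c s : R) : c ^+ 2 + s ^+ 2 = 1 ->
  gaussian_invariant (planar_rotation n c s).
Proof.
move=> cs f mf f0; set B := planar_rotation n c s.
have mfB : measurable_fun setT (fun z => f (mul_tuple B z)).
  exact: (measurableT_comp mf (measurable_mul_tuple B)).
pose cons2 (z : (T * T) * n.-tuple R) : n.+2.-tuple R :=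
  cons_tuple_pair (z.1.1, cons_tuple_pair (z.1.2, z.2)).
have mcons2 : measurable_fun setT cons2.
  apply: (measurableT_comp (@measurable_cons_tuple_pair R n.+1)).
  apply/measurable_fun_pair => /=.
    exact: (measurableT_comp measurable_fst measurable_fst).
  apply: (measurableT_comp (@measurable_cons_tuple_pair R n)).
  apply/measurable_fun_pair => /=; last exact: measurable_snd.
  exact: (measurableT_comp measurable_snd measurable_fst).
pose h (z : T * T) := (\int[std_gaussian R n]_w f (cons2 (z, w)))%E.
have mh : measurable_fun setT h.
  exact: (measurable_fun_fubini_tonelli_F (fun z => f (cons2 z))
    (measurableT_comp mf mcons2) (fun z => f0 _)).
have h0 z : (0 <= h z)%E by apply: integral_ge0 => w _; exact: f0.
have std2E (g : n.+2.-tuple R -> \bar R) (mg : measurable_fun setT g)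
    (g0 : forall z, (0 <= g z)%E) :
  (\int[std_gaussian R n.+2]_z g z =
   \int[normal_prob 0 1]_x \int[normal_prob 0 1]_y
     \int[std_gaussian R n]_w g (cons2 ((x, y), w)))%E.
  rewrite (ge0_integral_std_gaussianS mg g0); apply: eq_integral => x _.
  apply: (ge0_integral_std_gaussianS (f := fun z => g (cons_tuple_pair (x, z)))) => //.
  exact: (measurableT_comp (measurableT_comp mg (@measurable_cons_tuple_pair R n.+1))
    (measurable_pair1 x)).
rewrite (std2E _ mf f0) (std2E _ mfB (fun z => f0 _)).
rewrite -[RHS](normal2_rotate cs mh h0).
apply: eq_integral => x _; apply: eq_integral => y _; apply: eq_integral => w _.
congr f; apply: col_tuple_inj; rewrite col_mul_tuple /cons2/= !col_tuple_cons.
exact: planar_rotationE.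
Qed.

(** The bottom blocks have no rows, hence are equal. *)
Lemma scale_col_mx10 (a x y : R) (w w' : 'cV[R]_0) : a * x = y ->
  a *: (col_mx x%:M w : 'cV[R]_(1 + 0)) = col_mx y%:M w'.
Proof.
by move=> <-; rewrite scale_col_mx scale_scalar_mx [a *: w]flatmx0 [w']flatmx0.
Qed.

Lemma gaussian_invariant_sign (a : R) : a ^+ 2 = 1 ->
  gaussian_invariant (a%:M : 'M[R]_1).
Proof.
move=> a2 f mf f0.
have mfa : measurable_fun setT (fun z => f (mul_tuple a%:M z)).
  exact: (measurableT_comp mf (measurable_mul_tuple a%:M)).
have /orP[/eqP ->|/eqP ->] : (a == 1) || (a == -1) by rewrite -eqf_sqr a2 expr1n.
  apply: eq_integral => z _; congr f; apply: col_tuple_inj.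
  by rewrite col_mul_tuple mul1mx.
pose g (x : T) := (\int[std_gaussian R 0]_w f (cons_tuple_pair (x, w)))%E.
have mg : measurable_fun setT g by exact: measurable_section_std.
have g0 x : (0 <= g x)%E by apply: integral_ge0 => w _; exact: f0.
rewrite (ge0_integral_std_gaussianS mf f0) -[RHS](normal_opp mg g0).
rewrite (ge0_integral_std_gaussianS
  (measurableT_comp mf (measurable_mul_tuple _)) (fun z => f0 _)).
apply: eq_integral => x _; apply: eq_integral => w _.
congr f; apply: col_tuple_inj; rewrite col_mul_tuple !col_tuple_cons.
rewrite mul_scalar_mx; exact: scale_col_mx10 (mulN1r x).
Qed.

(** Inside the last [n] coordinates, an orthogonal matrix makes the second
    coordinate the only nonzero one; a planar rotation then kills it. Only a sign
    is left when there is a single coordinate. *)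
Lemma orthogonal_to_first n (v : 'cV[R]_(1 + n)) : dotv v v = 1 ->
  (forall Q : 'M[R]_n, orthogonalmx Q -> gaussian_invariant Q) ->
  exists G : 'M[R]_(1 + n), [/\ orthogonalmx G, gaussian_invariant G^T &
    G *m v = col_mx 1%:M 0].
Proof.
case: n v => [|n] v; rewrite -(vsubmxK v) [usubmx v]mx11_scalar dotv_col_mx;
    set a := usubmx v 0 0; set w := dsubmx v;
    rewrite dotv_scalar => vv IH.
  have aa : a ^+ 2 = 1 by move: vv; rewrite /dotv (flatmx0 w) trmx0 mul0mx mxE addr0.
  exists (a%:M : 'M[R]_1); split.
  - by rewrite /orthogonalmx tr_scalar_mx -scalar_mxM -expr2 aa.
  - by rewrite tr_scalar_mx; exact: gaussian_invariant_sign.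
  rewrite mul_scalar_mx; by apply: scale_col_mx10; rewrite -expr2 aa.
pose b := Num.sqrt (dotv w w); pose u : 'cV[R]_(1 + n) := col_mx b%:M 0.
have bb : b * b = dotv w w by rewrite -expr2 sqr_sqrtr// dotv_ge0.
have wu : dotv w w = dotv u u.
  by rewrite /u dotv_col_mx dotv_scalar bb dotv0l addr0.
have [P oP Pw] := orthogonal_map wu.
have ab : a ^+ 2 + (- b) ^+ 2 = 1 by rewrite sqrrN !expr2 bb.
pose B (X : 'M[R]_(1 + n)) : 'M[R]_(1 + (1 + n)) := block_mx 1%:M 0 0 X.
have BT X : (B X)^T = B X^T by rewrite /B tr_block_mx trmx1 !trmx0.
exists (planar_rotation n a (- b) *m B P); split.
- apply: orthogonalmxM; first exact: planar_rotation_orthogonal.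
  rewrite /orthogonalmx BT /B mulmx_block !mulmx0 !mul0mx !addr0 !add0r mulmx1.
  by rewrite oP -scalar_mx_block.
- rewrite trmx_mul BT planar_rotationT opprK; apply: gaussian_invariantM.
    exact/gaussian_invariant_block/IH/orthogonalmxT.
  by apply: gaussian_invariant_planar; rewrite -[b ^+ 2]sqrrN.
rewrite -mulmxA /B mul_block_col !mul0mx addr0 add0r mul1mx Pw /u planar_rotationE.
have -> : a * a - - b * b = 1 by rewrite -ab; ring.
have -> : - b * a + a * b = 0 by ring.
by rewrite raddf0 col_mx0.
Qed.

(** The transpose also fixes the first basis vector, so the first row is
    trivial as well as the first column. *)
Lemma orthogonal_block n (Q : 'M[R]_(1 + n)) : orthogonalmx Q ->
  Q *m col_mx 1%:M 0 = col_mx 1%:M 0 ->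
  exists2 Q' : 'M[R]_n, orthogonalmx Q' & Q = block_mx 1%:M 0 0 Q'.
Proof.
move=> oQ Qe.
have QTe : Q^T *m col_mx 1%:M 0 = col_mx 1%:M 0 by rewrite -{1}Qe mulmxA oQ mul1mx.
have QE : Q = block_mx 1%:M 0 0 (drsubmx Q).
  move: Qe QTe; rewrite -{1 2}(submxK Q) tr_block_mx !mul_block_col !mulmx0 !addr0 !mulmx1.
  move=> /eq_col_mx[ul dl] /eq_col_mx[_ ur].
  by rewrite -[LHS]submxK ul dl -[ursubmx Q]trmxK ur trmx0.
exists (drsubmx Q) => //; move: oQ; rewrite /orthogonalmx QE block_mxKdr tr_block_mx.
rewrite mulmx_block !trmx0 !mul0mx !mulmx0 !add0r [1%:M in RHS]scalar_mx_block.
by move=> /eq_block_mx[].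
Qed.

(** Move the image of the first basis vector back to that vector; what remains
    acts on the other coordinates only. *)
Lemma std_gaussian_rotation n (Q : 'M[R]_n) :
  orthogonalmx Q -> gaussian_invariant Q.
Proof.
elim: n Q => [|n IHn] Q oQ.
  by move=> f mf f0; apply: eq_integral => z _; rewrite (tuple0 (mul_tuple _ _)) (tuple0 z).
pose e : 'cV[R]_(1 + n) := col_mx 1%:M 0.
have ee : dotv e e = 1 by rewrite dotv_col_mx dotv_scalar dotv0l addr0 mulr1.
have e1 : dotv (Q *m e) (Q *m e) = 1 by rewrite dotv_orthogonal.
have [G [oG iG Ge]] := orthogonal_to_first e1 IHn.
have [||Q' oQ' Q'E] := @orthogonal_block n (G *m Q).
- exact: orthogonalmxM.
- by rewrite -mulmxA.
have -> : Q = G^T *m (G *m Q) by rewrite mulmxA oG mul1mx.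
by apply: gaussian_invariantM => //; rewrite Q'E; exact/gaussian_invariant_block/IHn.
Qed.

End rotation_invariance.

(** * Moments of Gaussian vectors *)

Section moments.
Context (R : realType) (n : nat).
Local Notation std := (std_gaussian R n).
Implicit Types u v : 'cV[R]_n.

Lemma measurable_dotv_tuple u :
  measurable_fun setT (fun z : n.-tuple R => dotv u (col_tuple z)).
Proof.
rewrite (_ : (fun _ => _) = fun z => \sum_i u i 0 * tnth z i); last first.
  by apply/funext => z; rewrite dotvE; apply: eq_bigr => i _; rewrite mxE.
apply: measurable_sum => i; apply: measurable_funM => //; exact: measurable_tnth.
Qed.

(** By rotation invariance [u] may be taken along the first axis, where the
    integral is the variance of [N(0, 1)]. *)
Lemma std_gaussian_sqr u :
  (\int[std]_z (dotv u (col_tuple z) ^+ 2)%:E = (dotv u u)%:E)%E.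
Proof.
have mf v : measurable_fun setT (fun z : n.-tuple R => (dotv v (col_tuple z) ^+ 2)%:E).
  by apply/measurable_EFinP; apply: measurable_funX; exact: measurable_dotv_tuple.
case: n u mf => [|m] u mf.
  rewrite integral0_eq => [|z _]; rewrite (flatmx0 u) dotv0l ?expr0n//.
pose b := Num.sqrt (dotv u u); pose e : 'cV[R]_(1 + m) := col_mx b%:M 0.
have bb : b * b = dotv u u by rewrite -expr2 sqr_sqrtr// dotv_ge0.
have ue : dotv u u = dotv e e by rewrite dotv_col_mx dotv_scalar dotv0l addr0 bb.
have [Q oQ Qu] := orthogonal_map ue.
rewrite -(std_gaussian_rotation (orthogonalmxT oQ) (mf u)); last first.
  by move=> z; rewrite lee_fin sqr_ge0.
under eq_integral => z _.
  rewrite col_mul_tuple dotvC dotv_mulmxl trmxK Qu dotvC.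
  over.
rewrite (ge0_integral_std_gaussianS (mf e)); last first.
  by move=> z; rewrite lee_fin sqr_ge0.
transitivity (\int[normal_prob 0 1]_x ((b ^+ 2)%:E * ((x : R) ^+ 2)%:E))%E.
  apply: eq_integral => x _.
  rewrite (eq_integral (cst (b ^+ 2 * x ^+ 2)%:E)).
    by rewrite integral_cst//= probability_setT mule1 EFinM.
  move=> w _; rewrite col_tuple_cons.
  by rewrite (_ : dotv e _ = b * x) ?exprMn// dotv_col_mx dotv_scalar dotv0l addr0.
rewrite ge0_integralZl//; last 3 first.
- by apply/measurable_EFinP; exact: measurable_funX.
- by move=> x _; rewrite lee_fin sqr_ge0.
- by rewrite lee_fin sqr_ge0.
by rewrite normal_prob01_second_moment mule1 expr2 bb.
Qed.

Lemma integrable_std_sqr u :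
  std.-integrable setT (fun z => (dotv u (col_tuple z) ^+ 2)%:E).
Proof.
apply/integrableP; split.
  by apply/measurable_EFinP; apply: measurable_funX; exact: measurable_dotv_tuple.
under eq_integral do rewrite gee0_abs ?lee_fin ?sqr_ge0//.
by rewrite std_gaussian_sqr ltry.
Qed.

(** Polarization of std_gaussian_sqr. *)
Lemma std_gaussian_mul u v :
  std.-integrable setT (fun z => (dotv u (col_tuple z) * dotv v (col_tuple z))%:E) /\
  (\int[std]_z (dotv u (col_tuple z) * dotv v (col_tuple z))%:E = (dotv u v)%:E)%E.
Proof.
have E z : ((dotv u (col_tuple z) * dotv v (col_tuple z))%:E =
    (4^-1)%:E * ((dotv (u + v) (col_tuple z) ^+ 2)%:E -
                 (dotv (u - v) (col_tuple z) ^+ 2)%:E))%E.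
  by rewrite -EFinB -EFinM !dotvBE; congr (_%:E); field.
have iB : std.-integrable setT (fun z => (dotv (u + v) (col_tuple z) ^+ 2)%:E -
                 (dotv (u - v) (col_tuple z) ^+ 2)%:E)%E.
  by apply: integrableB => //; exact: integrable_std_sqr.
split.
  by apply: eq_integrable (integrableZl measurableT 4^-1 iB) => // z _; rewrite E.
under eq_integral do rewrite E.
rewrite integralZl// integralB//; try exact: integrable_std_sqr.
rewrite !std_gaussian_sqr -EFinB -EFinM; congr (_%:E).
by rewrite !dotvBE (dotvC v u); field.
Qed.

(** The law is invariant under [z -> - z]. As invariance is about nonnegative
    functions, it is applied to [(1 + <u, z>)^2], whose integral is
    [1 + 2 E<u, z> + |u|^2]. *)
Lemma std_gaussian_lin u :
  std.-integrable setT (fun z => (dotv u (col_tuple z))%:E) /\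
  (\int[std]_z (dotv u (col_tuple z))%:E = 0)%E.
Proof.
have i1 : std.-integrable setT (cst 1%:E : n.-tuple R -> \bar R).
  exact: finite_measure_integrable_cst.
have iu w : std.-integrable setT (fun z => (dotv w (col_tuple z))%:E).
  apply: (@le_integrable _ _ _ _ _ measurableT _
    (fun z => 1%:E + (dotv w (col_tuple z) ^+ 2)%:E)%E).
  - by apply/measurable_EFinP; exact: measurable_dotv_tuple.
  - move=> z _ /=; rewrite lee_fin; set t := dotv _ _.
    rewrite [leRHS]ger0_norm ?addr_ge0 ?sqr_ge0// ler_norml.
    by apply/andP; split; nra.
  - by apply: integrableD => //; exact: integrable_std_sqr.
split => //.
have expand w : (\int[std]_z ((1 + dotv w (col_tuple z)) ^+ 2)%:E =
    1%:E + 2%:E * \int[std]_z (dotv w (col_tuple z))%:E + (dotv w w)%:E)%E.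
  under eq_integral => z _.
    rewrite (_ : ((1 + dotv w (col_tuple z)) ^+ 2)%:E = (cst 1%:E z +
      2%:E * (dotv w (col_tuple z))%:E + (dotv w (col_tuple z) ^+ 2)%:E)%E); last first.
      by rewrite -EFinM -!EFinD; congr (_%:E); ring.
    over.
  rewrite integralD//; last 2 first.
  - by apply: integrableD => //; exact: integrableZl.
  - exact: integrable_std_sqr.
  rewrite integralD//; last exact: integrableZl.
  by rewrite integral_cst//= probability_setT mule1 integralZl// std_gaussian_sqr.
have oN : orthogonalmx ((-1)%:M : 'M[R]_n).
  by rewrite /orthogonalmx tr_scalar_mx -scalar_mxM mulrNN mulr1.
have mf : measurable_fun setT (fun z : n.-tuple R => ((1 + dotv u (col_tuple z)) ^+ 2)%:E).
  apply/measurable_EFinP; apply: measurable_funX; apply: measurable_funD => //.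
  exact: measurable_dotv_tuple.
have := std_gaussian_rotation oN mf (fun z => sqr_ge0 _).
under eq_integral do rewrite col_mul_tuple mul_scalar_mx scaleN1r dotvNr -dotvNl.
rewrite !expand dotvNl dotvNr opprK.
have -> : (\int[std]_z (dotv (- u) (col_tuple z))%:E =
    - \int[std]_z (dotv u (col_tuple z))%:E)%E.
  under eq_integral do rewrite dotvNl -mulN1r EFinM.
  by rewrite integralZl// mulN1e.
have /integrable_fin_num := iu u => /(_ measurableT).
case: (integral _ _ _) => // r _; rewrite -!EFinN -!EFinM -!EFinD => -[].
by move=> H; congr (_%:E); lra.
Qed.

Lemma std_gaussian_quadratic (c : R) (l : 'cV[R]_n) (M : 'M[R]_n) :
  std.-integrable setT (fun z =>
    (c + dotv l (col_tuple z) + dotv (col_tuple z) (M *m col_tuple z))%:E) /\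
  (\int[std]_z (c + dotv l (col_tuple z) + dotv (col_tuple z) (M *m col_tuple z))%:E
   = (c + \tr M)%:E)%E.
Proof.
pose q i (z : n.-tuple R) := ((dotv (delta_mx i 0) (col_tuple z) *
  dotv (M^T *m delta_mx i 0) (col_tuple z))%:E)%E.
have iq i : std.-integrable setT (q i) by exact: (std_gaussian_mul _ _).1.
have E z : ((c + dotv l (col_tuple z) + dotv (col_tuple z) (M *m col_tuple z))%:E =
    cst c%:E z + (dotv l (col_tuple z))%:E + \sum_i q i z)%E.
  rewrite !EFinD; congr (_ + _)%E; rewrite sumEFin dotvE; congr (_%:E).
  have dE (w : 'cV[R]_n) i : dotv (delta_mx i 0) w = w i 0.
    rewrite dotvE (bigD1 i)//= big1 ?addr0 ?mxE ?eqxx ?mul1r// => j /negPf ji.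
    by rewrite mxE ji mul0r.
  by apply: eq_bigr => i _; rewrite dotv_mulmxl trmxK !dE.
have ic : std.-integrable setT (cst c%:E : n.-tuple R -> \bar R).
  exact: finite_measure_integrable_cst.
have [il l0] := std_gaussian_lin l.
have isum : std.-integrable setT (fun z => \sum_i q i z)%E by exact: integrable_sum.
split.
  apply: eq_integrable (integrableD measurableT (integrableD measurableT ic il) isum) => //.
under eq_integral do rewrite E.
rewrite integralD//; last exact: integrableD.
rewrite integralD// l0 adde0 integral_cst//= probability_setT mule1 integral_sum//.
rewrite EFinD; congr (_ + _)%E; rewrite /mxtrace -sumEFin; apply: eq_bigr => i _.
rewrite (std_gaussian_mul _ _).2 dotvC dotv_mulmxl trmxK -colE dotvE (bigD1 i)//=.
rewrite big1 ?addr0 ?mxE ?eqxx ?mul1r// => j /negPf ji.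
by rewrite mxE ji mul0r.
Qed.

End moments.

Section measurability.
Context (R : realType).

Lemma measurable_cV_coord n (i : 'I_n) :
  measurable_fun setT (fun x : 'cV[R]_n => x i 0).
Proof.
move=> _ Y mY; rewrite setTI; apply: sub_sigma_algebra => /=.
rewrite -bigcup_seq/=; exists i => /=; first by rewrite mem_index_enum.
by exists Y => //; rewrite setTI.
Qed.

Context d (T : measurableType d) (n : nat).
Implicit Types f g : T -> 'cV[R]_n.

Lemma measurable_cV_coord_comp f i :
  measurable_fun setT f -> measurable_fun setT (fun t => f t i 0).
Proof. by move=> mf; exact: (measurableT_comp (measurable_cV_coord i) mf). Qed.

Lemma measurable_dotv f g : measurable_fun setT f -> measurable_fun setT g ->
  measurable_fun setT (fun t => dotv (f t) (g t)).
Proof.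
move=> mf mg; rewrite (_ : (fun _ => _) = fun t => \sum_i f t i 0 * g t i 0).
  apply: measurable_sum => i.
  by apply: measurable_funM; exact: measurable_cV_coord_comp.
by apply/funext => t; rewrite dotvE.
Qed.

Lemma measurable_subv f g : measurable_fun setT f -> measurable_fun setT g ->
  measurable_fun setT (fun t => f t - g t).
Proof.
move=> mf mg; apply: measurable_fun_cV => i.
rewrite (_ : (fun _ => _) = fun t => f t i 0 - g t i 0).
  by apply: measurable_funB; exact: measurable_cV_coord_comp.
by apply/funext => t; rewrite !mxE.
Qed.

Lemma measurable_mulv (M : 'M[R]_n) f : measurable_fun setT f ->
  measurable_fun setT (fun t => M *m f t).
Proof.
move=> mf; apply: measurable_fun_cV => i.
rewrite (_ : (fun _ => _) = fun t => \sum_j M i j * f t j 0).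
  apply: measurable_sum => j; apply: measurable_funM => //.
  exact: measurable_cV_coord_comp.
by apply/funext => t; rewrite !mxE.
Qed.

End measurability.

Section marginals.
Context d1 d2 (X : measurableType d1) (Y : measurableType d2) (R : realType).
Variables (pi : probability X R) (mu : probability Y R) (phi : X -> Y).
Hypothesis mphi : measurable_fun setT phi.
Hypothesis marg : forall B, measurable B -> pushforward pi phi B = mu B.

Lemma integral_marginal (f : Y -> \bar R) : mu.-integrable setT f ->
  pi.-integrable setT (f \o phi) /\
  (\int[pi]_x (f \o phi) x = \int[mu]_y f y)%E.
Proof.
move=> fi; have mf := measurable_int _ fi.
have push (g : Y -> \bar R) :
    (\int[pushforward pi phi]_y g y = \int[mu]_y g y)%E.
  by apply: eq_measure_integral => B mB _; exact: marg.
have fphi : pi.-integrable setT (f \o phi).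
  apply/integrableP; split; first exact: measurableT_comp.
  have mabs : measurable_fun setT (fun y => `|f y|)%E by exact: measurableT_comp.
  have /= := ge0_integral_pushforward mphi pi measurableT mabs (fun y _ => abse_ge0 _).
  rewrite preimage_setT push => <-.
  by have /integrableP[] := fi.
split=> //.
have := integral_pushforward mphi mf (D := setT).
rewrite preimage_setT => /(_ pi fphi measurableT) <-.
exact: push.
Qed.

End marginals.

Section gaussian_moments.
Context (R : realType) (n : nat).

Lemma affine_mapE (x : 'cV[R]_n) B z : affine_map x B z = x + B *m col_tuple z.
Proof. by []. Qed.

Lemma gaussian_quadratic (x l : 'cV[R]_n) (S M : 'M[R]_n) :
  possemidefmx S ->
  let q := fun m : 'cV[R]_n => (dotv l (m - x) + dotv (m - x) (M *m (m - x)))%:E in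
  (gaussian x S).-integrable setT q /\
  (\int[gaussian x S]_m q m = (\tr (M *m S))%:E)%E.
Proof.
move=> psdS q; have [[sB _] BB] := sqrtmx_spec psdS.
set B := sqrtmx S in sB BB *.
have mq : measurable_fun setT q.
  apply/measurable_EFinP.
  have ms : measurable_fun setT (fun m : 'cV[R]_n => m - x) by exact: measurable_subv.
  apply: measurable_funD; apply: measurable_dotv => //.
  exact: measurable_mulv.
have [qi qE] := std_gaussian_quadratic 0 (B^T *m l) (B^T *m M *m B).
have E : q \o affine_map x B = fun z => (0 + dotv (B^T *m l) (col_tuple z) +
    dotv (col_tuple z) (B^T *m M *m B *m col_tuple z))%:E.
  apply/funext => z; rewrite /q /= affine_mapE addrAC subrr !add0r.
  by rewrite dotvC dotv_mulmxl dotvC [in X in _ + X]dotv_mulmxl !mulmxA.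
have qa : (std_gaussian R n).-integrable setT (q \o affine_map x B) by rewrite E.
have ma := @measurable_affine_map R n x B.
split.
  by apply: (integrable_pushforward ma mq); rewrite ?preimage_setT.
have := integral_pushforward ma mq (D := setT).
rewrite preimage_setT => /(_ (std_gaussian R n) qa measurableT).
rewrite E qE add0r => ->; congr (_%:E).
by rewrite sB -mulmxA mxtrace_mulC -mulmxA BB.
Qed.

End gaussian_moments.

(** * Optimal transport between Gaussians *)

Section transport.
Context (R : realType) (n : nat) (A Smu Snu : 'M[R]_n) (xmu xnu : 'cV[R]_n).
Hypothesis psdA : possemidefmx A.
Hypothesis psdmu : possemidefmx Smu.
Hypothesis psdnu : possemidefmx Snu.
Local Notation C := (sqrtmx A).
Local Notation d := (C *m (xmu - xnu)).
Local Notation mu := (gaussian xmu Smu).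
Local Notation nu := (gaussian xnu Snu).
Let Tmu := C *m Smu *m C.
Let Tnu := C *m Snu *m C.

Lemma normA_sqr (x : 'cV[R]_n) : normA A x ^+ 2 = dotv (C *m x) (C *m x).
Proof.
rewrite /normA /norm2 sqr_sqrtr ?sumr_ge0// => [|i _]; last exact: sqr_ge0.
by rewrite dotvE; apply: eq_bigr => i _; rewrite expr2.
Qed.

Lemma cost_ge0 z :
  (0 <= (normA A (z.1 - z.2 : 'cV[R]_n) ^+ 2)%:E)%E.
Proof. by rewrite lee_fin sqr_ge0. Qed.

Lemma measurable_cost : measurable_fun setT
  (fun z : 'cV[R]_n * 'cV[R]_n => (normA A (z.1 - z.2) ^+ 2)%:E).
Proof.
apply/measurable_EFinP; rewrite (_ : (fun _ => _) =
    fun z : 'cV[R]_n * 'cV[R]_n => dotv (C *m (z.1 - z.2)) (C *m (z.1 - z.2))).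
  by apply: measurable_dotv; apply: measurable_mulv; apply: measurable_subv;
    (exact: measurable_fst || exact: measurable_snd).
by apply/funext => z; rewrite normA_sqr.
Qed.

Lemma sandwich_possemidef S : possemidefmx S -> possemidefmx (C *m S *m C).
Proof.
move=> psdS; have [[sC _] _] := sqrtmx_spec psdA.
by rewrite -{1}sC; exact: possemidefmx_congr.
Qed.

(** The difference of the two sides is the quadratic form of [P] at
    [u - P' v]. *)
Lemma young_dotv (P P' : 'M[R]_n) (u v : 'cV[R]_n) :
  possemidefmx P -> P'^T = P' -> P *m P' = 1%:M ->
  2 * dotv u v <= dotv u (P *m u) + dotv v (P' *m v).
Proof.
move=> /possemidefmxP[sP pP] sP' PP'.
have := pP (u - P' *m v); rewrite mulmxBr mulmxA PP' mul1mx !dotvBE.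
rewrite !(dotv_mulmxl P') sP' (mulmxA P' P) (mulmx1C PP') mul1mx (dotvC v u).
lra.
Qed.

(** Weak duality: the cost dominates a function of the first point plus a
    function of the second, both quadratic, whose integrals are computed from
    the marginals. *)
Lemma coupling_cost_lower (P P' : 'M[R]_n)
    (pi : probability ('cV[R]_n * 'cV[R]_n)%type R) :
  possemidefmx P -> P'^T = P' -> P *m P' = 1%:M -> couplings mu nu pi ->
  ((dotv d d + \tr Tmu + \tr Tnu - (\tr (P *m Tmu) + \tr (P' *m Tnu)))%:E <=
   \int[pi]_z (normA A (z.1 - z.2) ^+ 2)%:E)%E.
Proof.
move=> psdP sP' PP' [marg1 marg2]; have [[sC _] CC] := sqrtmx_spec psdA.
pose q (x l : 'cV[R]_n) M := fun m : 'cV[R]_n =>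
  (dotv l (m - x) + dotv (m - x) (M *m (m - x)))%:E.
pose l := 2 *: (C *m d).
pose M1 := C *m (1%:M - P) *m C; pose M2 := C *m (1%:M - P') *m C.
have [i1 e1] := gaussian_quadratic xmu l M1 psdmu.
have [i2 e2] := gaussian_quadratic xnu (- l) M2 psdnu.
have [j1 f1] := integral_marginal measurable_fst marg1 i1.
have [j2 f2] := integral_marginal measurable_snd marg2 i2.
have trE Q S : \tr (C *m (1%:M - Q) *m C *m S) =
    \tr (C *m S *m C) - \tr (Q *m (C *m S *m C)).
  rewrite -!mulmxA mxtrace_mulC -!mulmxA mulmxBl mul1mx linearB/=.
  by rewrite !mulmxA.
have ic : pi.-integrable setT (cst (dotv d d)%:E : 'cV[R]_n * 'cV[R]_n -> \bar R).
  exact: finite_measure_integrable_cst.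
pose q1 (z : 'cV[R]_n * 'cV[R]_n) := q xmu l M1 z.1.
pose q2 (z : 'cV[R]_n * 'cV[R]_n) := q xnu (- l) M2 z.2.
have j1' : pi.-integrable setT q1 := j1.
have j2' : pi.-integrable setT q2 := j2.
have f1' : (\int[pi]_z q1 z = (\tr (M1 *m Smu))%:E)%E := etrans f1 e1.
have f2' : (\int[pi]_z q2 z = (\tr (M2 *m Snu))%:E)%E := etrans f2 e2.
pose low z := (cst (dotv d d)%:E z + q1 z + q2 z)%E.
have ilow : pi.-integrable setT low.
  by apply: integrableD => //; exact: integrableD.
have lowE : (\int[pi]_z low z =
    (dotv d d + \tr Tmu + \tr Tnu - (\tr (P *m Tmu) + \tr (P' *m Tnu)))%:E)%E.
  rewrite /low integralD//; last exact: integrableD.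
  rewrite integralD// integral_cst//= probability_setT mule1.
  rewrite f1' f2' !trE -!EFinD; congr (_%:E).
  by rewrite -/Tmu -/Tnu; ring.
have low_le z : (low z <= (normA A (z.1 - z.2) ^+ 2)%:E)%E.
  case: z => m m'; rewrite /low /q1 /q2 /q /= -!EFinD lee_fin normA_sqr.
  pose u := C *m (m - xmu); pose v := C *m (m' - xnu).
  have -> : C *m (m - m') = d + u - v.
    rewrite /u /v -mulmxDr -mulmxBr; congr (_ *m _).
    by apply/colP => i; rewrite !mxE; ring.
  have lE w : dotv l w = 2 * dotv d (C *m w).
    by rewrite /l dotvZl dotv_mulmxl sC.
  have ME Q w : dotv w (C *m (1%:M - Q) *m C *m w) =
      dotv (C *m w) (C *m w) - dotv (C *m w) (Q *m (C *m w)).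
    by rewrite -!mulmxA -{1}sC -dotv_mulmxl mulmxBl mul1mx dotvDr dotvNr.
  rewrite dotvNl !lE /M1 /M2 !ME -/u -/v !dotvBE.
  rewrite (dotvC u d) (dotvC v d) (dotvC v u).
  have := young_dotv u v psdP sP' PP'; lra.
rewrite -lowE.
(* A coupling of infinite cost has nothing to prove, and otherwise the cost is
   integrable. *)
have [ioo|ioo] := eqVneq (\int[pi]_z (normA A (z.1 - z.2) ^+ 2)%:E)%E +oo%E.
  by rewrite ioo leey.
apply: le_integral => //.
apply/integrableP; split; first exact: measurable_cost.
under eq_integral do rewrite gee0_abs ?cost_ge0//.
by rewrite ltey.
Qed.

(** The coupling is the joint law of [xmu + Smu^(1/2) Z] and
    [xnu + Snu^(1/2) O Z]; its second marginal is right because [O Z] and [Z]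
    have the same law. *)
Lemma coupling_cost_attained (O : 'M[R]_n) : orthogonalmx O ->
  exists2 pi, couplings mu nu pi &
  (\int[pi]_z (normA A (z.1 - z.2) ^+ 2)%:E =
   (dotv d d + \tr Tmu + \tr Tnu
     - 2 * \tr ((C *m sqrtmx Smu)^T *m (C *m sqrtmx Snu) *m O))%:E)%E.
Proof.
move=> oO; have [[sC _] _] := sqrtmx_spec psdA.
have [[sBmu _] BBmu] := sqrtmx_spec psdmu.
have [[sBnu _] BBnu] := sqrtmx_spec psdnu.
set Bmu := sqrtmx Smu in sBmu BBmu *; set Bnu := sqrtmx Snu in sBnu BBnu *.
pose F (z : n.-tuple R) := (affine_map xmu Bmu z, affine_map xnu (Bnu *m O) z).
have mF : measurable_fun setT F.
  by apply/measurable_fun_pair; exact: measurable_affine_map.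
pose Fp : {mfun n.-tuple R >-> ('cV[R]_n * 'cV[R]_n)%type} :=
  HB.pack F (isMeasurableFun.Build _ _ _ _ F mF).
pose pi : probability ('cV[R]_n * 'cV[R]_n)%type R :=
  distribution (std_gaussian R n) Fp.
exists pi.
  split=> B mB //.
  rewrite /gaussian /pi /distribution /pushforward.
  pose E := affine_map xnu Bnu @^-1` B.
  have mE : measurable E.
    by rewrite -[E]setTI; exact: (measurable_affine_map xnu Bnu).
  have mI : measurable_fun setT (fun z => (\1_E z)%:E : \bar R).
    by apply/measurable_EFinP; exact: measurable_indic.
  have I0 z : (0 <= (\1_E z)%:E :> \bar R)%E by rewrite lee_fin.
  have mOE : measurable (mul_tuple O @^-1` E).
    by rewrite -[X in measurable X]setTI; exact: (measurable_mul_tuple O).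
  have iI G : measurable G ->
      (\int[std_gaussian R n]_z (\1_G z)%:E = std_gaussian R n G)%E.
    by move=> mG; rewrite integral_indic// setIT.
  have := std_gaussian_rotation oO mI I0; rewrite (iI E mE) => invE.
  apply: etrans invE; transitivity (std_gaussian R n (mul_tuple O @^-1` E)).
    2: by rewrite -(iI _ mOE).
  apply: (congr1 (std_gaussian R n)); apply/seteqP; split=> z /=;
    by rewrite /E /= !affine_mapE col_mul_tuple mulmxA.
rewrite ge0_integral_distribution; last 2 first.
- exact: measurable_cost.
- exact: cost_ge0.
pose W := C *m Bmu - C *m Bnu *m O.
have [_] := std_gaussian_quadratic (dotv d d) (2 *: (W^T *m d)) (W^T *m W).
have -> : dotv d d + \tr (W^T *m W) = dotv d d + \tr Tmu + \tr Tnu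
     - 2 * \tr ((C *m Bmu)^T *m (C *m Bnu) *m O).
  rewrite -(addrA _ (\tr Tmu)) -addrA; congr (_ + _).
  set X := C *m Bmu; set Y := C *m Bnu.
  have XX : X *m X^T = Tmu by rewrite trmx_mul sBmu sC /X !mulmxA -(mulmxA C) BBmu.
  have YY : Y *m Y^T = Tnu by rewrite trmx_mul sBnu sC /Y !mulmxA -(mulmxA C) BBnu.
  have trYO : \tr ((Y *m O)^T *m (Y *m O)) = \tr Tnu.
    by rewrite mxtrace_mulC trmx_mul mulmxA -(mulmxA Y) orthogonalmxC// mulmx1 YY.
  have trYX : \tr ((Y *m O)^T *m X) = \tr (X^T *m Y *m O).
    by rewrite -mxtrace_tr trmx_mul trmxK mulmxA.
  have -> : W^T = X^T - (Y *m O)^T by rewrite -linearB.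
  have -> : W = X - Y *m O by [].
  rewrite mulmxBl !mulmxBr !linearB/= trYO trYX (mulmxA X^T Y).
  by rewrite (mxtrace_mulC X^T) XX; ring.
move=> <-; apply: eq_integral => z _; congr (_%:E).
rewrite /= normA_sqr !affine_mapE; set t := col_tuple z.
have -> : C *m (xmu + Bmu *m t - (xnu + Bnu *m O *m t)) = d + W *m t.
  rewrite /W mulmxBl -!mulmxA -mulmxBr -mulmxDr; congr (_ *m _).
  by apply/colP => i; rewrite !mxE; ring.
have -> : dotv (2 *: (W^T *m d)) t = 2 * dotv d (W *m t).
  by rewrite dotvZl dotv_mulmxl trmxK.
rewrite -mulmxA -dotv_mulmxl; set w := W *m t.
by rewrite !dotvDl !dotvDr (dotvC w d); ring.
Qed.

End transport.

Lemma posdefmx_possemidefmx (R : realType) n (M : 'M[R]_n) :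
  posdefmx M -> possemidefmx M.
Proof.
move=> [sM pM]; split=> // v; have [->|/pM/ltW//] := eqVneq v 0.
by rewrite mulmx0 mxE.
Qed.

Theorem theorem12 (R : realType) (n : nat) (A Smu Snu : 'M[R]_n)
    (xmu xnu : 'cV[R]_n)
    (hA : posdefmx A) (hmu : possemidefmx Smu) (hnu : possemidefmx Snu) :
  let Tmu := sqrtmx A *m Smu *m sqrtmx A in
  let Tnu := sqrtmx A *m Snu *m sqrtmx A in
  (wasserstein A (gaussian xmu Smu) (gaussian xnu Snu) ^+ 2)%E =
  (normA A (xmu - xnu) ^+ 2 + \tr Tmu + \tr Tnu
    - 2 * \tr (sqrtmx (sqrtmx Tmu *m Tnu *m sqrtmx Tmu)))%:E.
Proof.
move=> Tmu Tnu; have psdA := posdefmx_possemidefmx hA.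
have [[sC _] _] := sqrtmx_spec psdA.
have psdTmu : possemidefmx Tmu by exact: sandwich_possemidef.
have psdTnu : possemidefmx Tnu by exact: sandwich_possemidef.
have [psdS SS] := sqrtmx_spec psdTmu; set S := sqrtmx Tmu in psdS SS *.
have [sS _] := psdS.
have psdSTS : possemidefmx (S *m Tnu *m S) by rewrite -{1}sS; exact: possemidefmx_congr.
have [psdD DD] := sqrtmx_spec psdSTS; set D := sqrtmx _ in psdD DD *.
have [sD _] := psdD.
rewrite normA_sqr//; set V := _ - _.
have lower pi : couplings (gaussian xmu Smu) (gaussian xnu Snu) pi ->
    (V%:E <= \int[pi]_z (normA A (z.1 - z.2) ^+ 2)%:E)%E.
  move=> cpi; apply/lee_addgt0Pr => e e0.
  have [P [P' [psdP sP' PP' le_tr]]] := fidelity_dual psdS psdTnu psdD DD e0.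
  rewrite -leeBlDr//; apply: le_trans (coupling_cost_lower psdA hmu hnu psdP sP' PP' cpi).
  by move: le_tr; rewrite SS -EFinB lee_fin -/Tmu -/Tnu /V; lra.
have [[sBmu _] BBmu] := sqrtmx_spec hmu; have [[sBnu _] BBnu] := sqrtmx_spec hnu.
have [||O oO trO] := @fidelity_attained _ _ S D (sqrtmx A *m sqrtmx Smu)
    (sqrtmx A *m sqrtmx Snu) sS sD.
- by rewrite trmx_mul sBmu sC !mulmxA -(mulmxA (sqrtmx A)) BBmu SS.
- by rewrite DD trmx_mul sBnu sC /Tnu !mulmxA -(mulmxA (S *m sqrtmx A) (sqrtmx Snu)) BBnu.
have [pi cpi piE] := coupling_cost_attained xmu xnu psdA hmu hnu oO.
have infE : ereal_inf [set (\int[pi]_z ((normA A (z.1 - z.2) ^+ 2)%:E))%E |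
    pi in couplings (gaussian xmu Smu) (gaussian xnu Snu)]%classic = V%:E.
  apply/le_anti/andP; split.
    apply: ereal_inf_lbound; exists pi => //.
    by rewrite piE trO.
  by apply/ereal_infP => _ [pi' cpi' <-]; exact: lower.
have V0 : 0 <= V.
  rewrite -lee_fin -infE; apply/ereal_infP => _ [pi' _ <-].
  by apply: integral_ge0 => z _; exact: cost_ge0.
by rewrite /wasserstein infE expe2 /= -EFinM -expr2 sqr_sqrtr.
Qed.
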